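(* Let $\mu$ be a probability measure on $\Omega$ satisfying (A1), (A2), (A3) and (A4). Then: (1) $\mu$-almost surely there are neither infinite primal contours nor infinite dual contours; (2) $\mu$-almost surely there are no infinite clusters.
   Context: Let $G$ be the square grid with vertex set $\mathbb{Z}^2$, where $(m,n)$ and $(m',n')$ are adjacent iff $|m-m'|+|n-n'|=1$. The face of $G$ with lower-left corner $(m,n)$ is black if $m+n$ is even, white otherwise. $\Omega\subset\{0,1\}^{\mathbb{Z}^2}$ is the set of $\omega$ such that for every black face the states of its four vertices, listed clockwise from the lower-left corner, form one of $0000,1111,0011,1100,0110,1001$. A cluster of $\omega$ is a maximal $G$-connected set of vertices on which $\omega$ is constant; infinite if it has infinitely many vertices. Let $\mathbb{L}_1$ be the graph with vertices $(m-\tfrac12,n+\tfrac12)$, $m,n$ both even, and $\mathbb{L}_2$ the graph with vertices $(m-\tfrac12,n+\tfrac12)$, $m,n$ both odd; in each, two vertices are joined by an edge (a straight segment of length 2) iff they are at Euclidean distance $2$. The center of each black face $F$ of $G$ is the midpoint of exactly one edge $e_1$ of $\mathbb{L}_1$ and one edge $e_2$ of $\mathbb{L}_2$, and these are perpendicular. For $\omega\in\Omega$ define $\phi(\omega)\in\{0,1\}^{E(\mathbb{L}_1)\cup E(\mathbb{L}_2)}$: for each black face $F$, if its configuration is $0000$ or $1111$ both $e_1,e_2$ get $0$; if the two upper vertices of $F$ have a common state different from the common state of the two lower vertices, the horizontal one among $e_1,e_2$ gets $1$ and the vertical one $0$; if the two left vertices have a common state different from that of the two right vertices, the vertical one gets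 $1$ and the horizontal one $0$. Edges with value $1$ are present. A contour is a connected component of the set of present edges; each contour consists entirely of edges of $\mathbb{L}_1$ (primal contour) or entirely of edges of $\mathbb{L}_2$ (dual contour), and is infinite if it has infinitely many edges. Assumptions on a probability measure $\mu$ on $\Omega$: (A1) invariance under translations by the group generated by $(1,1),(1,-1)$; (A2) every $2\mathbb{Z}\times2\mathbb{Z}$-translation-invariant event has probability $0$ or $1$; (A3) invariance under $\theta(\omega)=1-\omega$; (A4) finite energy: let $\nu_1$ be the law of the restriction of $\phi(\omega)$ to $E(\mathbb{L}_1)$ when $\omega\sim\mu$; for a face $S$ of $\mathbb{L}_1$ and a configuration $\psi\in\{0,1\}^{E(\mathbb{L}_1)}$ let $\psi_S$ be obtained by flipping the states of the four sides of $S$; for an event $E$ let $E_S=\{\psi_S:\psi\in E\}$; then $\nu_1(E_S)>0$ whenever $\nu_1(E)>0$. *)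

(* Defs.v *)
From HB Require Import structures.
From mathcomp Require Import all_boot all_order all_algebra.
From mathcomp Require Import all_classical all_reals all_analysis.
From Stdlib Require Import Relations.

Set Implicit Arguments. Unset Strict Implicit. Unset Printing Implicit Defensive.
Import Order.TTheory GRing.Theory Num.Theory.
Local Open Scope classical_set_scope.
Local Open Scope ring_scope.

Definition vertex := (int * int)%type.

Definition cfg := vertex -> bool.

Definition adjG (v w : vertex) : Prop := `|v.1 - w.1| + `|v.2 - w.2| = 1.

(* the face with lower-left corner (m,n) is black iff m+n is even *)
Definition black (m n : int) : Prop := ~~ odd (absz (m + n)).

Definition face_states (w : cfg) (m n : int) : bool * bool * bool * bool :=
  (w (m, n), w (m, n + 1), w (m + 1, n + 1), w (m + 1, n)).

Definition allowed_patterns : seq (bool * bool * bool * bool) :=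
  [:: (false, false, false, false); (true, true, true, true);
      (false, false, true, true); (true, true, false, false);
      (false, true, true, false); (true, false, false, true)].

Definition Omega : set cfg :=
  [set w | forall m n : int, black m n -> face_states w m n \in allowed_patterns].

Definition same_state_adj (w : cfg) (v v' : vertex) : Prop :=
  adjG v v' /\ w v = w v'.

Definition cluster (w : cfg) (v : vertex) : set vertex :=
  [set v' | clos_refl_trans vertex (same_state_adj w) v v'].

Definition has_infinite_cluster (w : cfg) : Prop :=
  exists v : vertex, ~ finite_set (cluster w v).

(* The lattices L1 (primal, l = false) and L2 (dual, l = true).              *)
(* All planar points are written in DOUBLED coordinates (x,y) = (2X,2Y), so  *)
(* that the half-integer points of the paper become integer points.          *)
(* L1 vertices: (m-1/2, n+1/2) with m = 2a, n = 2b even;                     *)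
(* L2 vertices: (m-1/2, n+1/2) with m = 2a+1, n = 2b+1 odd;                  *)
(* they are indexed by (a,b) in Z^2.                                         *)

Definition latpt (l : bool) (ab : int * int) : int * int :=
  let m := if l then 2 * ab.1 + 1 else 2 * ab.1 in
  let n := if l then 2 * ab.2 + 1 else 2 * ab.2 in
  (2 * m - 1, 2 * n + 1).

(* An edge of L_l (two vertices at Euclidean distance 2) is indexed by the
   index (a,b) of its lower/left endpoint and a flag h: h = true means the
   other endpoint has index (a+1,b), h = false means (a,b+1). This is a
   bijection onto the edge set of L_l. *)
Definition edge := ((int * int) * bool)%type.

Definition ends (l : bool) (e : edge) : (int * int) * (int * int) :=
  let ab := e.1 in
  (latpt l ab, latpt l (if e.2 then (ab.1 + 1, ab.2) else (ab.1, ab.2 + 1))).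

Definition horizontal (l : bool) (e : edge) : Prop :=
  (ends l e).1.2 = (ends l e).2.2.

Definition vertical (l : bool) (e : edge) : Prop :=
  (ends l e).1.1 = (ends l e).2.1.

(* the center (m+1/2, n+1/2) of the face with lower-left corner (m,n) is the
   midpoint of e; in doubled coordinates 2*(2m+1,2n+1) = p + q. *)
Definition center_is_midpoint (l : bool) (e : edge) (m n : int) : Prop :=
  2 * (2 * m + 1) = (ends l e).1.1 + (ends l e).2.1 /\
  2 * (2 * n + 1) = (ends l e).1.2 + (ends l e).2.2.

Definition upper_lower_split (w : cfg) (m n : int) : Prop :=
  w (m, n + 1) = w (m + 1, n + 1) /\ w (m, n) = w (m + 1, n) /\
  w (m, n + 1) <> w (m, n).

Definition left_right_split (w : cfg) (m n : int) : Prop :=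
  w (m, n) = w (m, n + 1) /\ w (m + 1, n) = w (m + 1, n + 1) /\
  w (m, n) <> w (m + 1, n).

Definition present (w : cfg) (l : bool) (e : edge) : Prop :=
  exists m n : int, black m n /\ center_is_midpoint l e m n /\
    ((horizontal l e /\ upper_lower_split w m n) \/
     (vertical l e /\ left_right_split w m n)).

Definition phi (w : cfg) (l : bool) (e : edge) : bool := `[< present w l e >].

Definition share_endpoint (l : bool) (e f : edge) : Prop :=
  (ends l e).1 = (ends l f).1 \/ (ends l e).1 = (ends l f).2 \/
  (ends l e).2 = (ends l f).1 \/ (ends l e).2 = (ends l f).2.

Definition contour_step (w : cfg) (l : bool) (e f : edge) : Prop :=
  present w l e /\ present w l f /\ share_endpoint l e f.

Definition contour (w : cfg) (l : bool) (e : edge) : set edge :=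
  [set f | clos_refl_trans edge (contour_step w l) e f].

Definition has_infinite_contour (w : cfg) (l : bool) : Prop :=
  exists e : edge, present w l e /\ ~ finite_set (contour w l e).

Definition cfg_cylinders : set (set cfg) :=
  [set A | exists (v : vertex) (b : bool), A = [set w | w v = b]].

Definition Cfg := g_sigma_algebraType cfg_cylinders.

Definition ecfg := edge -> bool.

Definition ecfg_cylinders : set (set ecfg) :=
  [set A | exists (e : edge) (b : bool), A = [set psi | psi e = b]].

Definition ECfg := g_sigma_algebraType ecfg_cylinders.

Definition phi1 (w : Cfg) : ECfg := phi w false.

Definition translate (t : vertex) (w : Cfg) : Cfg :=
  fun v => w (v.1 - t.1, v.2 - t.2).

Definition theta (w : Cfg) : Cfg := fun v => ~~ w v.

(* the four sides of the face S of L1 whose lower-left corner has index ab *)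
Definition side_of (ab : int * int) (e : edge) : Prop :=
  e = (ab, true) \/ e = (ab, false) \/
  e = ((ab.1, ab.2 + 1), true) \/ e = ((ab.1 + 1, ab.2), false).

Definition flip_face (ab : int * int) (psi : ECfg) : ECfg :=
  fun e => if `[< side_of ab e >] then ~~ psi e else psi e.

(* Main.v *)
Require Import Defs.
From HB Require Import structures.
From mathcomp Require Import all_boot all_order all_algebra.
From mathcomp Require Import all_classical all_reals all_analysis.
From mathcomp Require Import measurable_realfun zify.
Set Implicit Arguments.
Unset Strict Implicit.
Unset Printing Implicit Defensive.
Import Order.TTheory GRing.Theory Num.Theory.
Local Open Scope classical_set_scope.
Local Open Scope ring_scope.

(** A configuration is, up to a sign, the product of two spin functions, one on each lattice, and
    the contours of one lattice are the domain walls of the spins of the other.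

    Uniqueness of the infinite primal contour is a Burton-Keane argument. Flipping faces rewires a
    box arbitrarily; making a chessboard of spins in it joins all contours that enter the box from
    outside. So three infinite contours would give trifurcation boxes of positive density, whereas
    the number of disjoint trifurcation boxes is at most the size of the boundary of the region
    containing them; and two infinite contours could be merged into one. By translation the dual
    contours behave likewise.

    If infinite contours existed, there would be exactly one of each kind. Contours do not cross, so
    each spin function is constant along the infinite contour of its own lattice; the product of
    these two spins is a translation-invariant observable that [theta] flips, contradicting
    ergodicity.

    Finally, if all contours are finite, flipping one side of each of the finitely many contours
    near two given vertices changes finitely many states and makes the two states equal. It does
    not change the states on infinite clusters, so infinite clusters of both states cannot coexist;
    by symmetry and ergodicity there are none. *)

(** * Paths in a graph and disjoint trifurcations *)

Definition conn (T : Type) (e : rel T) (x y : T) : Prop :=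
  exists2 p, path e x p & last x p = y.

Lemma conn0 (T : Type) (e : rel T) x : conn e x x.
Proof. by exists [::]. Qed.

Lemma conn1 (T : Type) (e : rel T) x y : e x y -> conn e x y.
Proof. by move=> exy; exists [:: y]; rewrite //= exy. Qed.

Lemma conn_trans (T : Type) (e : rel T) x y z : conn e x y -> conn e y z -> conn e x z.
Proof.
move=> [p pxp <-] [q pq <-]; exists (p ++ q); last by rewrite last_cat.
by rewrite cat_path pxp.
Qed.

Lemma conn_ind (T : Type) (e : rel T) (P : T -> Prop) y :
  P y -> (forall x z, e x z -> conn e z y -> P z -> P x) -> forall x, conn e x y -> P x.
Proof.
move=> Py IH x [p + lp]; elim: p x lp => [|z p IHp] x /= lp; first by rewrite lp.
case/andP=> exz pz; apply: (IH x z) => //; first by exists p.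
exact: IHp.
Qed.

Lemma conn_sub (T : Type) (e e' : rel T) x y :
  (forall u v, e u v -> e' u v) -> conn e x y -> conn e' x y.
Proof.
move=> sub; move: x; apply: conn_ind => [|u v euv _]; first exact: conn0.
exact/conn_trans/conn1/sub.
Qed.

Lemma conn_sym (T : Type) (e : rel T) x y : symmetric e -> conn e x y -> conn e y x.
Proof.
move=> es; move: x; apply: conn_ind => [|u v euv _ yv]; first exact: conn0.
by apply: (conn_trans yv); apply: conn1; rewrite es.
Qed.

Lemma conn_invariant (T : Type) (e : rel T) (A : Type) (f : T -> A) x y :
  (forall u v, e u v -> f u = f v) -> conn e x y -> f x = f y.
Proof. by move=> fe; move: x; apply: conn_ind => // u v /fe ->. Qed.

Definition outside (T : Type) (K : pred T) (e : rel T) : rel T :=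
  fun u v => [&& e u v, ~~ K u & ~~ K v].

Definition inside (T : Type) (K : pred T) (e : rel T) : rel T :=
  fun u v => [&& e u v, K u & K v].

Lemma outside_sym (T : Type) (K : pred T) e : symmetric e -> symmetric (outside K e).
Proof. by move=> es u v; rewrite /outside es; congr andb; rewrite andbC. Qed.

Lemma inside_sym (T : Type) (K : pred T) e : symmetric e -> symmetric (inside K e).
Proof. by move=> es u v; rewrite /inside es; congr andb; rewrite andbC. Qed.

Lemma conn_outside (T : Type) (K : pred T) e x y : conn (outside K e) x y -> conn e x y.
Proof. by apply: conn_sub => u v /and3P[]. Qed.

Lemma conn_inside (T : Type) (K : pred T) e x y : conn (inside K e) x y -> conn e x y.
Proof. by apply: conn_sub => u v /and3P[]. Qed.

Definition port (T : Type) (K : pred T) (e : rel T) (u : T) : Prop :=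
  K u /\ exists2 v, ~~ K v & e u v.

(** The path from x to u is cut just before its first vertex in K. *)
Lemma conn_port (T : Type) (K : pred T) e x u : symmetric e -> ~~ K x -> K u ->
  conn e x u -> exists2 v, ~~ K v & (exists2 k, K k & e k v) /\ conn (outside K e) x v.
Proof.
move=> es + Ku xu; move: x xu; apply: conn_ind => [|x z exz _ IH]; first by rewrite Ku.
move=> Kx; case: (boolP (K z)) => [Kz|/[dup] Kz /IH [v Kv [vp zv]]].
  by exists x => //; split; [exists z => //; rewrite es|exact: conn0].
by exists v => //; split=> //; apply/conn_trans/zv/conn1; rewrite /outside exz Kx.
Qed.

Lemma conn_avoid (T : Type) (K : pred T) e x y : 
  (forall u, K u -> ~ conn e x u) -> conn e x y -> conn (outside K e) x y.
Proof.
move=> + xy; move: x xy; apply: conn_ind => [|x z exz zy IH] nK; first exact: conn0.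
have Kx : ~~ K x by apply/negP => /nK; apply; exact: conn0.
have Kz : ~~ K z by apply/negP => /nK; apply; exact: conn1.
apply/conn_trans/IH; first by apply: conn1; rewrite /outside exz Kx.
by move=> u Ku zu; apply: (nK u Ku); apply/conn_trans/zu/conn1.
Qed.

(* In the application, [I] indexes disjoint boxes, [C t x y] says that x and y are joined outside
   box t, [Rch t x] that x is joined to box t, and [R t x u] that x is joined to box u outside
   box t. *)
Section Trifurcation.
Variables (I X : eqType) (C : I -> X -> X -> Prop) (Rch : I -> X -> Prop).
Variable (R : I -> X -> I -> Prop).
Hypothesis Crefl : forall t x, C t x x.
Hypothesis Csym : forall t x y, C t x y -> C t y x.
Hypothesis Ctrans : forall t x y z, C t x y -> C t y z -> C t x z.
Hypothesis CRch : forall t x y, C t x y -> Rch t x -> Rch t y.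

Definition trif (d : seq X) t := exists x y z,
  [/\ x \in d, y \in d & z \in d] /\ [/\ Rch t x, Rch t y & Rch t z] /\
  [/\ ~ C t x y, ~ C t x z & ~ C t y z].

(** Induction on the number of boxes. Among all boxes t and points x of d joined to t, take a pair
    whose branch, the class of x under [C t], contains the fewest points of d. No other box lies in
    that branch, so t and the points of the branch can be removed together: at least one point is
    lost, and every other box is still a trifurcation for the remaining points. *)
Lemma trif_count (s : seq I) (d : seq X) : uniq s ->
  {in s &, forall t u, t <> u -> forall x y, R t x u -> R t y u -> C t x y} ->
  {in s &, forall t u, t <> u -> forall x y, R t x u -> C t x y -> R t y u} ->
  {in s & , forall t u, t <> u -> {in d, forall x, Rch t x -> R u x t \/ R t x u}} ->
  {in s, forall t, trif d t} -> (size s <= size d)%N.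
Proof.
move: {2}(size s) (erefl (size s)) => n.
elim: n s d => [|n IH] s d; first by move=> ->.
move=> sz us RC RCR RR Tr.
pose m t x := count (fun y => `[< C t x y >]) d.
pose mins k := `[< exists t x, [/\ t \in s, x \in d, Rch t x & m t x = k] >].
have [k0 k0P] : exists k, mins k.
  have [t ts] : exists t, t \in s.
    by case: (s) sz => // t s' _; exists t; exact: mem_head.
  have [x [y [z [[xd _ _] [[rx _ _] _]]]]] := Tr t ts.
  by exists (m t x); apply/asboolP; exists t, x.
have [k /asboolP[t [x [ts xd tx mk]]] kmin] := ex_minnP (ex_intro _ k0 k0P).
have {}kmin : forall u y, u \in s -> y \in d -> Rch u y -> (m t x <= m u y)%N.
  by move=> u y us' yd ry; rewrite mk; apply: kmin; apply/asboolP; exists u, y.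
(* A trifurcation inside a minimal branch would have a strictly smaller branch. *)
have nR : forall u, u \in s -> t <> u -> ~ R t x u.
  move=> u us' tu Rx; have ut : u <> t by move/esym.
  have [y1 [y2 [y3 [[d1 d2 d3] [[r1 r2 r3] [n12 n13 n23]]]]]] := Tr u us'.
  have key y y' : y \in d -> y' \in d -> Rch u y -> Rch u y' -> ~ C u y y' ->
     ~ R u y t -> ~ R u y' t -> False.
    move=> yd yd' ry ry' nyy' nR nR'.
    have cx z : z \in d -> Rch u z -> ~ R u z t -> C t x z.
      move=> zd rz nz; apply: (RC t u) => //.
      by case: (RR u t us' ts ut z zd rz).
    (* The branch of y at u is contained in the branch of x at t and lacks [y'], so it has fewer
       points of d. *)
    have := kmin u y us' yd ry; apply/negP; rewrite -ltnNge /m.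
    rewrite -!size_filter.
    set a := seq.filter _ _; set b := seq.filter _ _.
    have -> : a = seq.filter (fun z => `[< C u y z >]) b.
      rewrite /a /b -filter_predI; apply: eq_in_filter => z zd /=.
      apply/idP/idP => [/asboolP uyz|/andP[]//]; apply/andP; split; apply/asboolP => //.
      apply: cx => //; first exact: CRch ry.
      move=> Ruz; apply: nR; apply: (RCR u t us' ts ut z) => //; exact: Csym.
    rewrite size_filter ltn_neqAle count_size andbT -all_count.
    apply/negP => /allP /(_ y'); rewrite mem_filter yd' andbT.
    by move=> /(_ (introT (asboolP _) (cx _ yd' ry' nR'))) /asboolP.
  (* By [RC] at most one of the three branches of u leads to t, so two of them are available for
     [key]. *)
  have [R1|N1] := pselect (R u y1 t).
    have N2 : ~ R u y2 t by move=> R2; apply: n12; exact: (RC u t).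
    have N3 : ~ R u y3 t by move=> R3; apply: n13; exact: (RC u t).
    exact: (key y2 y3).
  have [R2|N2] := pselect (R u y2 t); last exact: (key y1 y2).
  have N3 : ~ R u y3 t by move=> R3; apply: n23; exact: (RC u t).
  exact: (key y1 y3).
(* The whole minimal branch is dropped; x itself goes, so [d'] is strictly shorter than d. *)
pose d' := seq.filter (fun y => ~~ `[< C t x y >]) d.
have sd y : y \in d' -> y \in d by rewrite mem_filter => /andP[].
have d'P y : y \in d -> ~ C t x y -> y \in d'.
  by move=> yd nC; rewrite mem_filter yd andbT; apply/asboolP.
have ss u : u \in rem t s -> u \in s by exact: mem_rem.
have ltd : (size d' < size d)%N.
  rewrite size_filter ltn_neqAle count_size andbT -all_count.
  by apply/negP => /allP /(_ x xd) /asboolP; apply.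
have szr : size (rem t s) = n by rewrite size_rem // sz.
rewrite sz -szr; apply: leq_trans ltd; rewrite ltnS; apply: IH => //.
- exact: rem_uniq.
- by move=> u v /ss us' /ss vs; exact: RC.
- by move=> u v /ss us' /ss vs; exact: RCR.
- by move=> u v /ss us' /ss vs uv y /sd; exact: RR.
move=> u; rewrite mem_rem_uniq // inE => /andP[/eqP ut us'].
have tu : t <> u by move/esym.
have RX y : y \in d -> Rch u y -> C t x y -> R u y t.
  move=> yd ry cxy; case: (RR u t us' ts ut y yd ry) => // Rty; exfalso.
  by apply: (nR u us' tu); apply: (RCR t u ts us' tu y) => //; exact: Csym.
(* Two of the three points at t lie off the branch of x, and they cannot both lead to u. This leaves
   a point z of [d'] that is joined to t outside u; it replaces any dropped point in the
   trifurcation of u. *)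
have [z zd' Rz] : exists2 z, z \in d' & R u z t.
  have [y1 [y2 [y3 [[d1 d2 d3] [[r1 r2 r3] [n12 n13 n23]]]]]] := Tr t ts.
  have key y y' : y \in d' -> y' \in d' -> Rch t y -> Rch t y' -> ~ C t y y' ->
      exists2 z, z \in d' & R u z t.
    move=> yd yd' ry ry' nyy.
    case: (RR t u ts us' tu y (sd _ yd) ry) => [|R1]; first by exists y.
    case: (RR t u ts us' tu y' (sd _ yd') ry') => [|R2]; first by exists y'.
    by case: nyy; apply: (RC t u).
  have [C1|N1] := pselect (C t x y1).
    apply: (key y2 y3) => //; apply: d'P => // C2.
      by apply: n12; exact/Ctrans/C2/Csym.
    by apply: n13; exact/Ctrans/C2/Csym.
  have [C2|N2] := pselect (C t x y2); last by apply: (key y1 y2) => //; exact: d'P.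
  apply: (key y1 y3) => //; apply: d'P => // C3.
  by apply: n23; exact/Ctrans/C3/Csym.
have rep y : y \in d -> Rch u y -> exists y', [/\ y' \in d', Rch u y' & C u y y'].
  move=> yd ry; have [cxy|nxy] := pselect (C t x y); last first.
    by exists y; split=> //; exact: d'P.
  have cyz : C u y z by apply: (RC u t) => //; exact: RX.
  by exists z; split=> //; exact: CRch ry.
have [y1 [y2 [y3 [[d1 d2 d3] [[r1 r2 r3] [n12 n13 n23]]]]]] := Tr u us'.
have [z1 [z1d z1r c1]] := rep _ d1 r1.
have [z2 [z2d z2r c2]] := rep _ d2 r2.
have [z3 [z3d z3r c3]] := rep _ d3 r3.
have tr y y' v v' : C u y v -> C u y' v' -> ~ C u y y' -> ~ C u v v'.
  move=> cyv cyv' n1 cv; apply: n1; apply: Ctrans (Csym cyv'); exact: Ctrans cv.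
exists z1, z2, z3; split; [by split|split; [by split|split]].
- exact: tr n12.
- exact: tr n13.
- exact: tr n23.
Qed.
End Trifurcation.

(** * Contours as coboundaries *)

Definition tip (e : edge) : vertex :=
  if e.2 then (e.1.1 + 1, e.1.2) else (e.1.1, e.1.2 + 1).

(** Only an edge based at u or at v can join them, so a search through four candidates suffices;
    this makes the relation boolean. *)
Definition adj (psi : ecfg) : rel vertex := fun u v =>
  has (fun e => psi e && ((e.1 == u) && (tip e == v) || (e.1 == v) && (tip e == u)))
    [:: (u, true); (u, false); (v, true); (v, false)].

Lemma adjP (psi : ecfg) u v : reflect
  (exists2 e, psi e & (e.1 = u /\ tip e = v) \/ (e.1 = v /\ tip e = u)) (adj psi u v).
Proof.
apply: (iffP hasP) => [[e _ /andP[pe /orP[]/andP[/eqP <- /eqP <-]]]|].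
- by exists e => //; left.
- by exists e => //; right.
move=> [[x h] pe uv]; exists (x, h).
  by case: uv => -[/= <- _]; case: h {pe}; rewrite !inE eqxx ?orbT.
by rewrite pe; case: uv => -[<- <-]; rewrite !eqxx ?orbT.
Qed.

Lemma adj_sym (psi : ecfg) : symmetric (adj psi).
Proof. by move=> u v; apply/adjP/adjP => -[e pe H]; exists e => //; apply/or_comm. Qed.

Lemma adj_edge (psi : ecfg) e : psi e -> adj psi e.1 (tip e).
Proof. by move=> pe; apply/adjP; exists e => //; left. Qed.

Definition norm (x : vertex) : nat := maxn `|x.1| `|x.2|.

Lemma adj_norm (psi : ecfg) u v : adj psi u v -> (norm v <= (norm u).+1)%N.
Proof.
by case/adjP=> -[[a b] []] pe /= [[<- <-]|[<- <-]]; rewrite /norm /tip /=; lia.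
Qed.

Lemma int_interval_ind (P : int -> Prop) (a b : int) : a <= b -> P a ->
  (forall k, a < k <= b -> P (k - 1) -> P k) -> P b.
Proof.
move=> ab Pa IH; have -> : b = a + `|b - a|%N by lia.
have : (`|b - a| <= `|b - a|)%N by [].
elim: {1 3}`|b - a|%N => [|n IHn] lt; first by rewrite addr0.
apply: IH; first lia.
have -> : a + n.+1%:Z - 1 = a + n by lia.
by apply: IHn; lia.
Qed.

Lemma line_const (A : Type) (f : int -> A) (a b : int) :
  (forall k, Num.min a b < k <= Num.max a b -> f k = f (k - 1)) -> f a = f b.
Proof.
wlog ab : a b / a <= b => [H|].
  case/orP: (le_total a b) => [/H//|ba H'].
  by symmetry; apply: (H _ _ ba) => k Hk; apply: H'; lia.
rewrite (min_idPl ab) (max_idPr ab) => fk.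
by apply: (int_interval_ind (P := fun k => f a = f k) ab) => // k /fk ->.
Qed.

Lemma conn_line (T : Type) (e : rel T) (p : int -> T) (a b : int) : symmetric e ->
  (forall k, Num.min a b < k <= Num.max a b -> e (p (k - 1)) (p k)) -> conn e (p a) (p b).
Proof.
move=> es; wlog ab : a b / a <= b => [H|].
  case/orP: (le_total a b) => [/H//|ba H'].
  by apply: conn_sym => //; apply: (H _ _ ba) => k Hk; apply: H'; lia.
rewrite (min_idPl ab) (max_idPr ab) => ek.
apply: (int_interval_ind (P := fun k => conn e (p a) (p k)) ab); first exact: conn0.
by move=> k /ek ekk ak; exact/(conn_trans ak)/conn1.
Qed.

(** The sum modulo 2 of g over the integers above [Num.min a b] and up to [Num.max a b]: a line
    integral, whose orientation does not matter. *)
Definition seg (g : int -> bool) (a b : int) : bool :=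
  \big[addb/false]_(k < `|b - a|) g (Num.min a b + k%:Z + 1).

Lemma seg_telescope (f g : int -> bool) a b :
  (forall i, g i = f i (+) f (i - 1)) -> seg g a b = f a (+) f b.
Proof.
move=> gE; have tel c n : \big[addb/false]_(k < n) g (c + k%:Z + 1) = f c (+) f (c + n).
  elim: n => [|n IH]; first by rewrite big_ord0 addr0 addbb.
  rewrite big_ord_recr /= IH gE.
  have -> : c + n + 1 - 1 = c + n by lia.
  have -> : c + n + 1 = c + n.+1 by lia.
  by case: (f c); case: (f (c + n)); case: (f (c + n.+1)).
rewrite /seg tel; have [ab|ba] := lerP a b.
  by rewrite (_ : a + `|b - a|%N = b) //; lia.
by rewrite (_ : b + `|b - a|%N = a) 1?addbC //; lia.
Qed.

Lemma seg_step g a b : seg g a b (+) seg g a (b - 1) = g b.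
Proof.
rewrite /seg; case: (boolP (a < b)) => ab.
  have -> : `|b - a|%N = (absz (b - 1 - a)%R).+1 by lia.
  rewrite big_ord_recr /= (_ : Num.min a b = Num.min a (b - 1)); last lia.
  rewrite (_ : Num.min a (b - 1) + (absz (b - 1 - a)%R)%:Z + 1 = b); last lia.
  by rewrite addbAC addbb addFb.
have -> : absz (b - 1 - a)%R = (`|b - a|%N).+1 by lia.
rewrite big_ord_recl /= (_ : Num.min a (b - 1) + 0%:Z + 1 = b); last lia.
rewrite addbCA [X in _ (+) X](_ : _ = false) ?addbF //.
set x := \big[_/_]_(_ < _) _; set y := \big[_/_]_(_ < _) _.
suff -> : x = y by rewrite addbb.
by apply: eq_bigr => k _; congr g; rewrite /bump /=; lia.
Qed.

Lemma segxx g a : seg g a a = false.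
Proof. by rewrite /seg subrr big_ord0. Qed.

Lemma seg_shift (g : int -> bool) (t a b : int) : seg (fun i => g (i - t)) (a + t) (b + t) = seg g a b.
Proof.
rewrite /seg (_ : absz (b + t - (a + t))%R = absz (b - a)%R); last lia.
have E (k : int) : Num.min (a + t) (b + t) + k + 1 - t = Num.min a b + k + 1 by lia.
by apply: eq_bigr => k _; rewrite E.
Qed.

(** The coboundary modulo 2 of spins on the faces of the lattice, each face being named by its
    lower-left corner: an edge is present when the two faces that it separates have different
    spins. *)
Definition cobord (s : vertex -> bool) : ecfg := fun e =>
  s e.1 (+) s (if e.2 then (e.1.1, e.1.2 - 1) else (e.1.1 - 1, e.1.2)).

(** The parity of the number of present edges crossed on the way from face x to face y, first along
    the row of x, then along the column of y. *)
Definition prim (psi : ecfg) (x y : vertex) : bool :=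
  seg (fun i => psi ((i, x.2), false)) x.1 y.1 (+) seg (fun j => psi ((y.1, j), true)) x.2 y.2.

Lemma prim_cobord s x y : prim (cobord s) x y = s x (+) s y.
Proof.
case: x y => [x1 x2] [y1 y2]; rewrite /prim /=.
rewrite (@seg_telescope (fun i => s (i, x2))) // (@seg_telescope (fun j => s (y1, j))) //.
by case: (s (x1, _)); case: (s (y1, x2)); case: (s (y1, y2)).
Qed.

Definition even_deg (psi : ecfg) := forall x : vertex,
  psi (x, true) (+) psi ((x.1 - 1, x.2), true) (+) psi (x, false) (+)
  psi ((x.1, x.2 - 1), false) = false.

Lemma even_deg_cobord s : even_deg (cobord s).
Proof.
move=> [a b]; rewrite /cobord /=.
by case: (s _); case: (s _); case: (s _); case: (s _).
Qed.

(** The grid has no holes, so psi can be integrated from the face (0, 0), along row 0 and then along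
    a column. Steps along a column are right by construction. *)
Lemma even_deg_exact (psi : ecfg) : even_deg psi -> exists s, psi = cobord s.
Proof.
move=> ev; pose s := prim psi (0, 0); exists s.
have sv i j : s (i, j) (+) s (i, j - 1) = psi ((i, j), true).
  rewrite -[RHS](seg_step (fun j => psi ((i, j), true)) 0) /s /prim /=.
  by rewrite addbACA addbb addFb.
suff sh i j : psi ((i, j), false) = s (i, j) (+) s (i - 1, j).
  by apply/funext => -[[i j] []]; rewrite /cobord /= ?sv ?sh.
(* [D] is the error of the row step at height j. The even degree at (i, k) makes it equal on rows k
   - 1 and k, and it vanishes on row 0. *)
pose D j := psi ((i, j), false) (+) (s (i, j) (+) s (i - 1, j)).
suff : D j = false by rewrite /D; case: (psi _); case: (s _); case: (s _).
rewrite (@line_const _ D j 0) => [|k _].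
  rewrite /D -(seg_step (fun k => psi ((k, 0), false)) 0 i) /s /prim /=.
  by rewrite !segxx !addbF addbb.
have := ev (i, k); rewrite /D -(sv i k) -(sv (i - 1) k) /=.
by case: (s _); case: (s _); case: (s _); case: (s _); case: (psi _); case: (psi _).
Qed.

(** Each side of S separates S from another face, so flipping the four sides amounts to flipping the
    spin of S. *)
Lemma flip_face_cobord S s : flip_face S (cobord s) = cobord (fun y => s y (+) (y == S)).
Proof.
apply/funext => -[[a b] h]; rewrite /flip_face /cobord.
have -> : `[< side_of S ((a, b), h) >] =
    ((a, b) == S) (+) ((if h then (a, b - 1) else (a - 1, b)) == S).
  case: S => [c d]; rewrite /side_of; apply/asboolP/idP => /=.
    case: h => -[[-> ->]|[[-> ->]|[[-> ->]|[-> ->]]]];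
      rewrite !xpair_eqE; lia.
  case: h; rewrite !xpair_eqE => H.
    have [e|e] : (a = c /\ b = d) \/ (a = c /\ b = d + 1) by lia.
      by left; case: e => -> ->.
    by right; right; left; case: e => -> ->.
  have [e|e] : (a = c /\ b = d) \/ (a = c + 1 /\ b = d) by lia.
    by right; left; case: e => -> ->.
  by right; right; right; case: e => -> ->.
rewrite /=; set A := _ == S; set B := _ == S.
by case: A; case: B; case: (s _); case: (s _).
Qed.

Lemma flips_cobord (F : seq vertex) s : uniq F ->
  foldr flip_face (cobord s) F = cobord (fun y => s y (+) (y \in F)).
Proof.
elim: F => [|S F IH] /=; first by move=> _; congr cobord; apply/funext => y; rewrite addbF.
case/andP=> SF /IH ->; rewrite flip_face_cobord; congr cobord; apply/funext => y.
rewrite inE; case: eqVneq => [->|]; last by rewrite addbF.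
by rewrite (negbTE SF) addbF.
Qed.

Lemma flip_faceK S : involutive (flip_face S).
Proof.
by move=> psi; apply/funext => e; rewrite /flip_face; case: asboolP => //; rewrite negbK.
Qed.

Lemma adj_cases (psi : ecfg) (a b : int) y : adj psi (a, b) y <->
  [\/ y = (a + 1, b) /\ psi ((a, b), true), y = (a - 1, b) /\ psi ((a - 1, b), true),
      y = (a, b + 1) /\ psi ((a, b), false) | y = (a, b - 1) /\ psi ((a, b - 1), false)].
Proof.
split=> [/adjP[[[c d] []] pe /= [[[? ?] <-]|[<- [? ?]]]]|]; try subst a b.
- by constructor 1.
- by constructor 2; rewrite addrK.
- by constructor 3.
- by constructor 4; rewrite addrK.
case=> -[-> pe]; apply/adjP.
- by exists ((a, b), true) => //; left.
- by exists ((a - 1, b), true) => //; right; rewrite /tip /= subrK.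
- by exists ((a, b), false) => //; left.
- by exists ((a, b - 1), false) => //; right; rewrite /tip /= subrK.
Qed.

(** Even degrees exclude dead ends. *)
Lemma adj_other (psi : ecfg) x y : even_deg psi -> adj psi x y ->
  exists2 y', y' <> y & adj psi x y'.
Proof.
case: x => a b /(_ (a, b)) /= ev /adj_cases xy.
case: xy => -[-> p]; rewrite p /= in ev.
- have /or3P[q|q|q] : [|| psi ((a - 1, b), true), psi ((a, b), false) | psi ((a, b - 1), false)].
    by move: ev; case: (psi ((a - 1, b), true)); case: (psi ((a, b), false)); case: (psi ((a, b - 1), false)).
  + by exists (a - 1, b); [case; lia|apply/adj_cases; constructor 2].
  + by exists (a, b + 1); [case; lia|apply/adj_cases; constructor 3].
  + by exists (a, b - 1); [case; lia|apply/adj_cases; constructor 4].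
- have /or3P[q|q|q] : [|| psi ((a, b), true), psi ((a, b), false) | psi ((a, b - 1), false)].
    by move: ev; case: (psi ((a, b), true)); case: (psi ((a, b), false)); case: (psi ((a, b - 1), false)).
  + by exists (a + 1, b); [case; lia|apply/adj_cases; constructor 1].
  + by exists (a, b + 1); [case; lia|apply/adj_cases; constructor 3].
  + by exists (a, b - 1); [case; lia|apply/adj_cases; constructor 4].
- have /or3P[q|q|q] : [|| psi ((a, b), true), psi ((a - 1, b), true) | psi ((a, b - 1), false)].
    by move: ev; case: (psi ((a, b), true)); case: (psi ((a - 1, b), true)); case: (psi ((a, b - 1), false)).
  + by exists (a + 1, b); [case; lia|apply/adj_cases; constructor 1].
  + by exists (a - 1, b); [case; lia|apply/adj_cases; constructor 2].
  + by exists (a, b - 1); [case; lia|apply/adj_cases; constructor 4].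
- have /or3P[q|q|q] : [|| psi ((a, b), true), psi ((a - 1, b), true) | psi ((a, b), false)].
    by move: ev; case: (psi ((a, b), true)); case: (psi ((a - 1, b), true)); case: (psi ((a, b), false)).
  + by exists (a + 1, b); [case; lia|apply/adj_cases; constructor 1].
  + by exists (a - 1, b); [case; lia|apply/adj_cases; constructor 2].
  + by exists (a, b + 1); [case; lia|apply/adj_cases; constructor 3].
Qed.

Definition int_range (n : nat) : seq int := [seq k%:Z - n%:Z | k <- iota 0 (n + n).+1].

Lemma mem_int_range n (i : int) : (i \in int_range n) = (`|i| <= n)%N.
Proof.
apply/mapP/idP => [[k + ->]|Hi]; first by rewrite mem_iota; lia.
by exists (absz (i + n%:Z)%R); [rewrite mem_iota; lia|lia].
Qed.

Definition ball_seq (n : nat) : seq vertex := [seq (i, j) | i <- int_range n, j <- int_range n].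

Lemma mem_ball_seq n x : (x \in ball_seq n) = (norm x <= n)%N.
Proof.
case: x => [i j]; rewrite /norm geq_max /=; apply/allpairsP/andP => [[[a b] /= [] + + [-> ->]]|].
  by rewrite !mem_int_range.
by move=> [Hi Hj]; exists (i, j); rewrite !mem_int_range.
Qed.

(** * Rewiring a box *)

Definition box (n : nat) (z : vertex) : pred vertex :=
  fun x => (norm (x.1 - z.1, x.2 - z.2)%R <= n)%N.

Section Rewiring.
Variables (s : vertex -> bool) (n : nat).
Hypothesis n2 : (2 <= n)%N.

(** The faces contained in the box; naming them by their lower-left corners makes the upper bounds
    strict. *)
Definition inner_face (y : vertex) : bool :=
  [&& - n%:Z <= y.1, y.1 < n%:Z, - n%:Z <= y.2 & y.2 < n%:Z].

Definition parity (y : vertex) : bool := odd `|y.1 + y.2|.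

Definition phase (a b : bool) : bool :=
  let i := if b then n%:Z - 1 else - n%:Z in
  ~~ s (if a then n%:Z else - n%:Z - 1, i) (+) parity (if a then n%:Z - 1 else - n%:Z, i).

(* Inside the box, a chessboard in each quadrant, whose phase is chosen so that the vertical
   box side ending at the corner of that quadrant is present. *)
Definition rewire (y : vertex) : bool :=
  if inner_face y then parity y (+) phase (0 <= y.1) (0 <= y.2) else s y.

Let K := box n (0, 0).
Let psi := cobord rewire.
Let e := inside K (adj psi).

Let KE x : K x = (norm x <= n)%N. 
Proof. by rewrite /K /box !subr0; case: x. Qed.

Let e_sym : symmetric e. Proof. exact/inside_sym/adj_sym. Qed.

Let e_edge x h : psi (x, h) -> K x -> K (tip (x, h)) -> e x (tip (x, h)).
Proof. by move=> px Kx Kt; rewrite /e /inside Kx Kt (adj_edge px). Qed.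

(** An edge of such a row separates two faces of the same quadrant, where the chessboard gives them
    different spins. *)
Let row (a a' b : int) : b != 0 -> (`|b| < n)%N -> (`|a| <= n)%N -> (`|a'| <= n)%N ->
  conn e (a, b) (a', b).
Proof.
move=> b0 bn an an'; apply: (conn_line (p := fun k => (k, b))) => // k Hk.
have := @e_edge (k - 1, b) true; rewrite /tip /= subrK; apply.
- rewrite /psi /cobord /rewire /inner_face /=.
  have -> : [&& - n%:Z <= k - 1, k - 1 < n%:Z, - n%:Z <= b & b < n%:Z] by lia.
  have -> : [&& - n%:Z <= k - 1, k - 1 < n%:Z, - n%:Z <= b - 1 & b - 1 < n%:Z] by lia.
  have -> : (0 <= b - 1) = (0 <= b) by lia.
  by rewrite /parity /=; case: phase; lia.
- by rewrite KE /norm /=; lia.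
- by rewrite KE /norm /=; lia.
Qed.

Let column (a b b' : int) : a != 0 -> (`|a| < n)%N -> (`|b| <= n)%N -> (`|b'| <= n)%N ->
  conn e (a, b) (a, b').
Proof.
move=> a0 an bn bn'; apply: (conn_line (p := fun k => (a, k))) => // k Hk.
have := @e_edge (a, k - 1) false; rewrite /tip /= subrK; apply.
- rewrite /psi /cobord /rewire /inner_face /=.
  have -> : [&& - n%:Z <= a, a < n%:Z, - n%:Z <= k - 1 & k - 1 < n%:Z] by lia.
  have -> : [&& - n%:Z <= a - 1, a - 1 < n%:Z, - n%:Z <= k - 1 & k - 1 < n%:Z] by lia.
  have -> : (0 <= a - 1) = (0 <= a) by lia.
  by rewrite /parity /=; case: phase; lia.
- by rewrite KE /norm /=; lia.
- by rewrite KE /norm /=; lia.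
Qed.

(** The points on the rows and columns of the box other than the axes and the sides. These lines are
    fully present and cross one another. *)
Let core (x : vertex) := K x && ((x.1 != 0) && (`|x.1| < n)%N || (x.2 != 0) && (`|x.2| < n)%N).

Let core_conn x : core x -> conn e x (1, 1).
Proof.
case: x => a b; rewrite /core KE /norm /= => /andP[Hn /orP[/andP[a0 an]|/andP[b0 bn]]].
  by apply: (@conn_trans _ _ _ (a, 1)); [apply: column|apply: row]; lia.
by apply: (@conn_trans _ _ _ (1, b)); [apply: row|apply: column]; lia.
Qed.

Let step_core x y : e x y -> core y -> conn e x (1, 1).
Proof. by move=> exy cy; exact/(conn_trans (conn1 exy))/core_conn. Qed.

(** The vertical box side at the corner is present by the choice of [phase], and since n is at least
    2 its other end lies in [core]. *)
Let corner (x : vertex) : `|x.1|%N = n -> `|x.2|%N = n -> conn e x (1, 1).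
Proof.
case: x => a b /= an bn.
have [->|->] : b = n%:Z \/ b = - n%:Z by lia.
  apply: (@step_core _ (a, n%:Z - 1)); last by rewrite /core KE /norm /=; lia.
  rewrite e_sym; have := @e_edge (a, n%:Z - 1) false; rewrite /tip /= subrK.
  rewrite !KE /norm /psi /cobord /rewire /inner_face /=; apply; [|lia|lia].
  have [->|->] : a = n%:Z \/ a = - n%:Z by lia.
    rewrite ltxx andbF /= ltrBlDr ltrDl ltr01 (_ : [&& _, _, _ & _]) /=; last lia.
    rewrite (_ : 0 <= n%:Z - 1) /phase /=; last lia.
    by case: (s _); case: (parity _).
  rewrite (_ : [&& _, _, _ & _]) /=; last lia.
  rewrite [X in if X then _ else _](_ : _ = false) /=; last lia.
  rewrite (_ : 0 <= n%:Z - 1) /=; last lia.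
  rewrite (_ : (0 <= - n%:Z) = false) /phase /=; last lia.
  by case: (s _); case: (parity _).
apply: (@step_core _ (a, - n%:Z + 1)); last by rewrite /core KE /norm /=; lia.
have := @e_edge (a, - n%:Z) false; rewrite /tip /=.
rewrite !KE /norm /psi /cobord /rewire /inner_face /=; apply; [|lia|lia].
have [->|->] : a = n%:Z \/ a = - n%:Z by lia.
  rewrite ltxx andbF /= ltrBlDr ltrDl ltr01 (_ : [&& _, _, _ & _]) /=; last lia.
  rewrite (_ : 0 <= n%:Z - 1) /phase /=; last lia.
  rewrite (_ : (0 <= - n%:Z) = false) /=; last lia.
  by case: (s _); case: (parity _).
rewrite (_ : [&& _, _, _ & _]) /=; last lia.
rewrite [X in if X then _ else _](_ : _ = false) /=; last lia.
rewrite (_ : (0 <= - n%:Z) = false) /phase /=; last lia.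
by case: (s _); case: (parity _).
Qed.

(* The degree at the end of a wall between two chessboards is even, so a present edge leaving
   the box there continues along the boundary or inwards. *)
Let wall (x y : vertex) : K x -> ~~ core x -> (`|x.1| < n)%N || (`|x.2| < n)%N ->
  ~~ K y -> adj psi x y -> conn e x (1, 1).
Proof.
case: x => a b; rewrite KE /core KE /norm /= => Kx ncx ncorner Ky xy.
have [[a' b'] /= y'y xy'] := adj_other (even_deg_cobord _) xy.
have [Ky' cy'] : K (a', b') /\ core (a', b').
  move: xy xy' y'y Ky => /adj_cases xy /adj_cases xy'.
  rewrite /core !KE /norm /=.
  case: xy => [[-> _]|[-> _]|[-> _]|[-> _]];
    case: xy' => [[[-> ->] _]|[[-> ->] _]|[[-> ->] _]|[[-> ->] _]] y'y /=;
    by [case: y'y|lia].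
by apply: (step_core _ cy'); apply/and3P; split=> //; rewrite KE.
Qed.

Lemma port_rewire x : port K (adj psi) x -> conn e x (1, 1).
Proof.
move=> [Kx [y Ky xy]]; have [/core_conn//|ncx] := boolP (core x).
have [nc|c] := boolP ((`|x.1| < n)%N || (`|x.2| < n)%N); first exact: (wall Kx ncx nc Ky).
by move: Kx c; rewrite KE /norm => Kx c; apply: corner; lia.
Qed.
End Rewiring.

Lemma ports_rewire s n u v : (2 <= n)%N ->
  let K := box n (0, 0) in let e := adj (cobord (rewire s n)) in
  port K e u -> port K e v -> conn (inside K e) u v.
Proof.
move=> n2 K e pu pv; apply: (conn_trans (port_rewire n2 pu)).
by apply: conn_sym; [exact/inside_sym/adj_sym|exact: port_rewire].
Qed.

Lemma rewire_outside s n e : ~~ (box n (0, 0) e.1 && box n (0, 0) (tip e)) ->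
  cobord (rewire s n) e = cobord s e.
Proof.
case: e => -[a b] h; rewrite /box !subr0 /norm /cobord /rewire /inner_face.
by case: h => /= nK; do 2![rewrite ifF; last lia].
Qed.

Lemma adj_rewire_outside s n u v : ~~ (box n (0, 0) u && box n (0, 0) v) ->
  adj (cobord (rewire s n)) u v = adj (cobord s) u v.
Proof.
move=> nK; apply/adjP/adjP => -[e pe uv]; exists e => //.
  by rewrite -(@rewire_outside s n) //; case: uv => -[-> ->] //; rewrite andbC.
by rewrite rewire_outside //; case: uv => -[-> ->] //; rewrite andbC.
Qed.

Lemma rewire_flips s n : exists F, foldr flip_face (cobord s) F = cobord (rewire s n).
Proof.
pose F := seq.filter (fun y => rewire s n y != s y) (undup (ball_seq n)).
exists F; rewrite flips_cobord ?filter_uniq ?undup_uniq //; congr cobord; apply/funext => y.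
rewrite mem_filter mem_undup mem_ball_seq.
case: (boolP (inner_face n y)) => [iy|niy]; last first.
  by rewrite /rewire (negbTE niy) eqxx addbF.
have -> : (norm y <= n)%N by move: iy; rewrite /inner_face /norm; lia.
by rewrite andbT; case: (s y); case: (rewire s n y).
Qed.

(** * Infinite contours and trifurcation boxes *)

(** Balls being finite, this says that the component of x is infinite; the countable quantifiers
    make it visibly measurable. *)
Definition unbounded (e : rel vertex) (x : vertex) : Prop :=
  forall m, exists2 y, conn e x y & (m <= norm y)%N.

Definition branch (K : pred vertex) (e : rel vertex) (x : vertex) : Prop :=
  [/\ ~~ K x, exists2 k, K k & e k x & unbounded (outside K e) x].

(** K has finitely many neighbours. If those joined to x all had bounded components off K, then the
    component of x would be bounded. *)
Lemma unbounded_branch (e : rel vertex) (K : pred vertex) N x u : symmetric e ->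
  (forall v w, e v w -> (norm w <= (norm v).+1)%N) -> (forall v, K v -> (norm v <= N)%N) ->
  unbounded e x -> K u -> conn e x u -> exists2 v, branch K e v & conn e x v.
Proof.
move=> es eN KN ux Ku xu; apply: contrapT => nb.
have {}nb v : conn e x v -> ~~ K v -> (exists2 k, K k & e k v) ->
    exists m, forall y, conn (outside K e) v y -> (norm y < m)%N.
  move=> xv Kv kv; apply: contrapT => nm; apply: nb; exists v => //; split=> // m.
  apply: contrapT => ny; apply: nm; exists m => y vy; rewrite ltnNge; apply/negP => my.
  by apply: ny; exists y.
have [f fP] : {f : vertex -> nat & forall v, conn e x v -> ~~ K v ->
    (exists2 k, K k & e k v) -> forall y, conn (outside K e) v y -> (norm y < f v)%N}.
  apply: (@choice _ _ (fun v m => conn e x v -> ~~ K v ->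
    (exists2 k, K k & e k v) -> forall y, conn (outside K e) v y -> (norm y < m)%N)) => v.
  have [[xv Kv kv]|H] := pselect [/\ conn e x v, ~~ K v & exists2 k, K k & e k v].
    by have [m mP] := nb v xv Kv kv; exists m.
  by exists 0%N => xv Kv kv; case: H.
(* Neighbours of K have norm at most N + 1, so the maximum bounds their components off K; the
   summand N + 1 excludes the points of K. *)
have [y xy] := ux (\max_(v <- ball_seq N.+1) f v + N.+1)%N.
rewrite leqNgt => /negP; apply.
have [Ky|Ky] := boolP (K y); first by have := KN _ Ky; lia.
have [|v Kv [[k Kk kv] yv]] := @conn_port _ K e y u es Ky Ku.
  by apply: conn_trans xu; exact: conn_sym.
have : (norm y < f v)%N.
  apply: fP => //; first by apply: (conn_trans xy); exact: conn_outside yv.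
    by exists k.
  by apply: conn_sym => //; exact: outside_sym.
move=> lt; apply: (leq_trans lt); apply: leq_trans (leq_addr _ _).
apply: leq_bigmax_seq => //; rewrite mem_ball_seq; apply: leq_trans (eN _ _ kv) _.
by rewrite ltnS; exact: KN.
Qed.

(** The first clause lets the box play the part of a single vertex: whatever enters it is joined
    inside it. The second provides three infinite branches that are separate off the box. *)
Definition trifurcation (n : nat) (z : vertex) (psi : ecfg) : Prop :=
  let K := box n z in let e := adj psi in
  (forall u v, port K e u -> port K e v -> conn (inside K e) u v) /\
  exists x y w, [/\ branch K e x, branch K e y & branch K e w] /\
    [/\ ~ conn (outside K e) x y, ~ conn (outside K e) x w & ~ conn (outside K e) y w].

Definition two_infinite (psi : ecfg) : Prop := exists x y,
  [/\ unbounded (adj psi) x, unbounded (adj psi) y & ~ conn (adj psi) x y].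

Definition three_infinite (psi : ecfg) : Prop := exists x y w,
  [/\ unbounded (adj psi) x, unbounded (adj psi) y & unbounded (adj psi) w] /\
  [/\ ~ conn (adj psi) x y, ~ conn (adj psi) x w & ~ conn (adj psi) y w].

Lemma box0 n x : box n (0, 0) x = (norm x <= n)%N.
Proof. by rewrite /box !subr0; case: x. Qed.

Lemma adj_branch (psi : ecfg) n x : (norm x <= n)%N -> unbounded (adj psi) x ->
  exists2 v, branch (box n (0, 0)) (adj psi) v & conn (adj psi) x v.
Proof.
move=> xn ux; apply: (@unbounded_branch _ _ n x x) => //.
- exact: adj_sym.
- exact: adj_norm.
- by move=> v; rewrite box0.
- by rewrite box0.
- exact: conn0.
Qed.

Lemma outside_rewire s n :
  outside (box n (0, 0)) (adj (cobord (rewire s n))) = outside (box n (0, 0)) (adj (cobord s)).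
Proof.
apply/funext => u; apply/funext => v; rewrite /outside.
by case: (boolP (box _ _ u)) => Ku; rewrite ?andbF //= adj_rewire_outside ?(negbTE Ku).
Qed.

Lemma branch_rewire s n x :
  branch (box n (0, 0)) (adj (cobord (rewire s n))) x <-> branch (box n (0, 0)) (adj (cobord s)) x.
Proof.
rewrite /branch outside_rewire; split=> -[Kx [k Kk kx] ux]; split=> //; exists k => //.
  by rewrite adj_rewire_outside ?(negbTE Kx) ?andbF // in kx.
by rewrite adj_rewire_outside // (negbTE Kx) andbF.
Qed.

Lemma three_infinite_rewire s : three_infinite (cobord s) ->
  exists n F, trifurcation n (0, 0) (foldr flip_face (cobord s) F).
Proof.
move=> [x [y [w [[ux uy uw] [nxy nxw nyw]]]]].
(* The box contains the three points, and n is at least 2 as the rewiring requires. *)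
pose n := (norm x + norm y + norm w).+2; exists n.
have [F EF] := rewire_flips s n; exists F; rewrite {F}EF; split.
  by move=> u v; exact: ports_rewire.
have [x' bx xx'] : exists2 v, branch (box n (0, 0)) (adj (cobord s)) v & conn (adj (cobord s)) x v.
  by apply: adj_branch => //; lia.
have [y' by_ yy'] : exists2 v, branch (box n (0, 0)) (adj (cobord s)) v & conn (adj (cobord s)) y v.
  by apply: adj_branch => //; lia.
have [w' bw ww'] : exists2 v, branch (box n (0, 0)) (adj (cobord s)) v & conn (adj (cobord s)) w v.
  by apply: adj_branch => //; lia.
exists x', y', w'; split; first by split; apply/branch_rewire.
have tr a b a' b' : conn (adj (cobord s)) a a' -> conn (adj (cobord s)) b b' ->
    ~ conn (adj (cobord s)) a b -> ~ conn (outside (box n (0, 0)) (adj (cobord s))) a' b'.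
  move=> aa' bb' nab a'b'; apply: nab; apply: (conn_trans aa').
  by apply: (conn_trans (conn_outside a'b')); apply: conn_sym => //; exact: adj_sym.
by rewrite outside_rewire; split; [exact: tr nxy|exact: tr nxw|exact: tr nyw].
Qed.

Lemma branch_port (psi : ecfg) K x : branch K (adj psi) x ->
  exists2 k, port K (adj psi) k & adj psi x k.
Proof. by move=> [Kx [k Kk kx] _]; exists k; [split=> //; exists x|rewrite adj_sym]. Qed.

(** The box is rewired around a point of each of two infinite contours. An infinite contour of the
    result that missed the box would have been a third one before the rewiring; hence all infinite
    contours enter the box, where they are joined. *)
Lemma two_infinite_rewire s : two_infinite (cobord s) -> ~ three_infinite (cobord s) ->
  exists F, ~ two_infinite (foldr flip_face (cobord s) F).
Proof.
move=> [x [y [ux uy nxy]]] n3.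
pose n := (norm x + norm y).+2; pose K := box n (0, 0).
have [F EF] := rewire_flips s n; exists F; rewrite {F}EF => -[x1 [y1 [ux1 uy1 n1]]].
set e := adj (cobord s) in ux uy nxy n3; set e' := adj (cobord (rewire s n)) in ux1 uy1 n1.
have es : symmetric e by exact: adj_sym.
have es' : symmetric e' by exact: adj_sym.
have hit v : unbounded e' v -> exists2 u, K u & conn e' v u.
  move=> uv; apply: contrapT => nh; apply: n3; exists x, y, v.
  have vo w : conn e' v w -> conn (outside K e) v w.
    by rewrite /e -outside_rewire; apply: conn_avoid => u Ku vu; apply: nh; exists u.
  have uv' : unbounded e v.
    by move=> m; have [w /vo vw mw] := uv m; exists w => //; exact: conn_outside vw.
  have nv w : unbounded e w -> (norm w <= n)%N -> ~ conn e w v.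
    move=> uw wn wv; have Kw : K w by rewrite /K box0.
    have Kv : ~~ K v by apply/negP => Kv; apply: nh; exists v => //; exact: conn0.
    have [p Kp [[k Kk kp] vp]] := conn_port es Kv Kw (conn_sym es wv).
    apply: nh; exists k => //; rewrite -outside_rewire in vp.
    apply: (conn_trans (conn_outside vp)); apply: conn1.
    by rewrite adj_sym adj_rewire_outside //; apply: contra Kp => /andP[].
  by split; split=> //; apply: nv => //; rewrite /n; lia.
have toport v : unbounded e' v -> exists2 k, port K e' k & conn e' v k.
  move=> uv; have [u Ku vu] := hit v uv.
  have [w bw vw] : exists2 w, branch K e' w & conn e' v w.
    apply: (@unbounded_branch e' K n v u) => //; first exact: adj_norm.
    by move=> p; rewrite /K box0.
  by have [k pk wk] := branch_port bw; exists k => //; exact/(conn_trans vw)/conn1.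
have [k pk xk] := toport _ ux1; have [k' pk' yk] := toport _ uy1.
apply: n1; apply: (conn_trans xk); apply: (conn_trans (y := k')); last exact: conn_sym.
by apply: (@conn_inside _ K); exact: ports_rewire.
Qed.

(** The path is cut where it first meets K or L; up to that point it avoids the other set. *)
Lemma first_hit (T : Type) (e : rel T) (K L : pred T) x u : symmetric e ->
  (forall v, K v -> ~~ L v) -> ~~ K x -> ~~ L x -> K u -> conn e x u ->
  (exists2 p, port K e p & conn (outside L e) x p) \/
  (exists2 p, port L e p & conn (outside K e) x p).
Proof.
move=> es KL + + Ku xu; move: x xu; apply: conn_ind => [|x z exz _ IH Kx Lx]; first by rewrite Ku.
have [Kz|Kz] := boolP (K z).
  left; exists z; first by split=> //; exists x; rewrite // es.
  by apply: conn1; rewrite /outside exz Lx KL.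
have [Lz|Lz] := boolP (L z).
  right; exists z; first by split=> //; exists x; rewrite // es.
  by apply: conn1; rewrite /outside exz Kx Kz.
have [[p pp zp]|[p pp zp]] := IH Kz Lz; [left|right]; exists p => //;
  by apply/conn_trans/zp/conn1; rewrite /outside exz ?Kx ?Lx.
Qed.

Definition sphere (N : nat) : seq vertex :=
  [seq (i, N%:Z) | i <- int_range N] ++ [seq (i, - N%:Z) | i <- int_range N] ++
  [seq (N%:Z, i) | i <- int_range N] ++ [seq (- N%:Z, i) | i <- int_range N].

Lemma map_int_rangeP (T : eqType) (f : int -> T) N y :
  reflect (exists2 i : int, (`|i| <= N)%N & y = f i) (y \in [seq f i | i <- int_range N]).
Proof.
by apply: (iffP mapP) => -[i]; [rewrite mem_int_range|rewrite -mem_int_range]; exists i.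
Qed.

Lemma size_sphere N : size (sphere N) = (4 * (N + N).+1)%N.
Proof. by rewrite /sphere !size_cat !size_map size_iota; lia. Qed.

Lemma mem_sphere N (x : vertex) : (x \in sphere N) = (norm x == N).
Proof.
case: x => a b; rewrite /sphere !mem_cat; apply/idP/eqP.
  by case/or4P=> /map_int_rangeP[i Hi [-> ->]]; rewrite /norm /=; lia.
rewrite {1}/norm {1}/fst {1}/snd => abN; have [e|[e|[e|e]]] : b = N%:Z \/ b = - N%:Z \/ a = N%:Z \/ a = - N%:Z by lia.
- by apply/or4P; constructor 1; apply/map_int_rangeP; exists a; rewrite ?e //; lia.
- by apply/or4P; constructor 2; apply/map_int_rangeP; exists a; rewrite ?e //; lia.
- by apply/or4P; constructor 3; apply/map_int_rangeP; exists b; rewrite ?e //; lia.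
- by apply/or4P; constructor 4; apply/map_int_rangeP; exists b; rewrite ?e //; lia.
Qed.

Lemma unbounded_sphere (e : rel vertex) N x :
  (forall v w, e v w -> (norm w <= (norm v).+1)%N) -> (norm x <= N)%N -> unbounded e x ->
  exists2 y, y \in sphere N & conn e x y.
Proof.
move=> eN + /(_ N)[y xy Ny]; move: x xy; apply: conn_ind => [yN|x z exz _ IH xN].
  by exists y; [rewrite mem_sphere eqn_leq yN|exact: conn0].
have [xN'|xN'] := boolP (norm x == N).
  by exists x; [rewrite mem_sphere|exact: conn0].
have [|w wN zw] := IH; first by apply: leq_trans (eN _ _ exz) _; rewrite ltn_neqAle xN'.
by exists w => //; exact/conn_trans/zw/conn1.
Qed.

(** The sphere of radius N surrounds all the boxes, so each unbounded branch has a point on it, and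
    [trif_count] applies with the sphere as set of points. A box whose ports are joined inside it is
    connected off every box disjoint from it, which gives the hypotheses on R. *)
Lemma trifurcation_count (psi : ecfg) n N (zs : seq vertex) : uniq zs ->
  {in zs &, forall z z', z <> z' -> forall v, box n z v -> ~~ box n z' v} ->
  {in zs, forall z, (norm z + n < N)%N} -> {in zs, forall z, trifurcation n z psi} ->
  (size zs <= 4 * (N + N).+1)%N.
Proof.
move=> uz dis zN tz; rewrite -size_sphere; set e := adj psi.
have es : symmetric e by exact: adj_sym.
pose B := box n; have oes z : symmetric (outside (B z) e) by exact: outside_sym.
have BN z v : z \in zs -> B z v -> (norm v < N)%N.
  by move=> /zN; rewrite /B /box /norm /=; lia.
have ns z v : z \in zs -> v \in sphere N -> ~~ B z v.
  by move=> zz; rewrite mem_sphere => /eqP vN; apply/negP => /(BN _ _ zz); rewrite vN ltnn.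
apply: (@trif_count _ _ (fun z => conn (outside (B z) e))
  (fun z x => exists2 u, B z u & conn e x u)
  (fun z x z' => exists2 u, port (B z') e u & conn (outside (B z) e) x u)) => //.
- by move=> z x; exact: conn0.
- by move=> z x y; exact: conn_sym.
- by move=> z x y w; exact: conn_trans.
- move=> z x y xy [u Bu xu]; exists u => //; apply/conn_trans/xu.
  by apply: conn_sym => //; exact: conn_outside xy.
- move=> z z' zz zz' nz x y [u pu xu] [v pv yv]; apply: (conn_trans xu).
  apply: (conn_trans (y := v)); last exact: conn_sym.
  have [inn _] := tz z' zz'; have := inn u v pu pv; apply: conn_sub => p q /and3P[pq Bp Bq].
  by apply/and3P; split=> //; apply: (dis z' z) => //; move/esym.
- by move=> z z' zz zz' nz x y [u pu xu] xy; exists u => //; apply/conn_trans/xu/conn_sym.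
- move=> z z' zz zz' nz x xN [u Bu xu]; apply: (first_hit _ _ _ _ Bu xu) => //; try exact: ns.
  exact: dis.
move=> z zz; have [_ [x [y [w [[bx by_ bw] [nxy nxw nyw]]]]]] := tz z zz.
have rep v : branch (B z) e v -> exists v', [/\ v' \in sphere N,
    exists2 u, B z u & conn e v' u & conn (outside (B z) e) v v'].
  move=> [Bv [k Bk kv] uv]; have [||v' vN vv'] := @unbounded_sphere (outside (B z) e) N v _ _ uv.
  - by move=> p q /and3P[pq _ _]; exact: adj_norm pq.
  - exact: leq_trans (adj_norm kv) (BN _ _ zz Bk).
  exists v'; split=> //; exists k => //; apply: (conn_trans (y := v)); last first.
    by apply: conn1; rewrite es.
  by apply: conn_sym => //; exact: conn_outside vv'.
have [x' [dx rx xx']] := rep _ bx; have [y' [dy ry yy']] := rep _ by_.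
have [w' [dw rw ww']] := rep _ bw.
have tr a b a' b' : conn (outside (B z) e) a a' -> conn (outside (B z) e) b b' ->
    ~ conn (outside (B z) e) a b -> ~ conn (outside (B z) e) a' b'.
  move=> aa' bb' nab a'b'; apply: nab; apply: (conn_trans aa').
  by apply: (conn_trans a'b'); exact: conn_sym.
exists x', y', w'; split; first by split.
by split; [by split|split; [exact: tr nxy|exact: tr nxw|exact: tr nyw]].
Qed.

(** * From configurations to contours *)

(** The lower-left corner of the black face centred at the midpoint of e. *)
Definition edge_face (l : bool) (e : edge) : vertex :=
  let d : int := if l then 1 else 0 in
  if e.2 then (2 * e.1.1 + d, 2 * e.1.2 + d) else (2 * e.1.1 - 1 + d, 2 * e.1.2 + 1 + d).

Lemma edge_face_black l e : black (edge_face l e).1 (edge_face l e).2.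
Proof. by case: e => -[a b] []; case: l; rewrite /black /edge_face /=; lia. Qed.

Lemma presentP w l e : present w l e <->
  if e.2 then upper_lower_split w (edge_face l e).1 (edge_face l e).2
  else left_right_split w (edge_face l e).1 (edge_face l e).2.
Proof.
split.
  move=> [m [n [_ [[]]]]]; case: e => -[a b] h; rewrite /horizontal /vertical /edge_face /=.
  rewrite /latpt => e1 e2; case: h e1 e2 => /= e1 e2.
    have -> : m = 2 * a + (if l then 1 else 0) by case: l e1 {e2} => /=; lia.
    have -> : n = 2 * b + (if l then 1 else 0) by case: l {e1} e2 => /=; lia.
    by move=> [[]|[v _]] //; exfalso; case: l v {e1 e2} => /=; lia.
  have -> : m = 2 * a - 1 + (if l then 1 else 0) by case: l e1 {e2} => /=; lia.
  have -> : n = 2 * b + 1 + (if l then 1 else 0) by case: l {e1} e2 => /=; lia.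
  by move=> [[v _]|[]] //; exfalso; case: l v {e1 e2} => /=; lia.
move=> H; exists (edge_face l e).1, (edge_face l e).2; split; first exact: edge_face_black.
move: H; case: e => -[a b] h; rewrite /center_is_midpoint /horizontal /vertical /edge_face /latpt.
by case: h; case: l => /= H; (split; first lia); [left|left|right|right].
Qed.

Lemma phi_translate i j w l e :
  phi (translate (2 * i, 2 * j) w) l e = phi w l ((e.1.1 - i, e.1.2 - j), e.2).
Proof.
apply: asbool_equiv_eq; rewrite !presentP; case: e => -[a b] h.
have -> : edge_face l ((a - i, b - j), h) =
    ((edge_face l ((a, b), h)).1 - 2 * i, (edge_face l ((a, b), h)).2 - 2 * j).
  by rewrite /edge_face; case: h => /=; congr pair; lia.
case: (edge_face _ _) => m n; rewrite /upper_lower_split /left_right_split /translate /=.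
by rewrite (addrAC m) (addrAC n).
Qed.

(** Translation by (1, 1) carries the first lattice onto the second and keeps the indices; primal
    statements thereby transfer to dual contours. *)
Lemma phi_dual w e : phi (translate (1, 1) w) true e = phi w false e.
Proof.
apply: asbool_equiv_eq; rewrite !presentP; case: e => -[a b] h.
have -> : edge_face false ((a, b), h) =
    ((edge_face true ((a, b), h)).1 - 1, (edge_face true ((a, b), h)).2 - 1).
  by rewrite /edge_face; case: h => /=; congr pair; lia.
case: (edge_face _ _) => m n; rewrite /upper_lower_split /left_right_split /translate /=.
by rewrite (addrAC m) (addrAC n).
Qed.

Lemma phi_theta w l : phi (theta w) l = phi w l.
Proof.
apply/funext => e; apply: asbool_equiv_eq; rewrite !presentP.
rewrite /upper_lower_split /left_right_split /theta; case: (edge_face _ _) => m n /=.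
by case: e.2; case: (w (m, n)); case: (w (m, n + 1)); case: (w (m + 1, n));
  case: (w (m + 1, n + 1)); split=> -[? [? ?]].
Qed.

Section Constrained.
Variable w : cfg.
Hypothesis Ow : Omega w.

(** The six patterns are those in which opposite sides show the same change of state and the states
    do not change in both directions. *)
Lemma Omega_face m n : black m n ->
  (w (m, n) (+) w (m, n + 1) = w (m + 1, n) (+) w (m + 1, n + 1)) /\
  (w (m, n) (+) w (m, n + 1)) && (w (m, n) (+) w (m + 1, n)) = false.
Proof.
move=> /(Ow); rewrite /face_states /allowed_patterns !inE !xpair_eqE.
by case: (w (m, n)); case: (w (m, n + 1)); case: (w (m + 1, n)); case: (w (m + 1, n + 1)).
Qed.

Lemma phiE l e : phi w l e =
  let f := edge_face l e in w f (+) w (if e.2 then (f.1, f.2 + 1) else (f.1 + 1, f.2)).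
Proof.
have := Omega_face (edge_face_black l e); have := presentP w l e.
case: (edge_face l e) => m n /=; rewrite /upper_lower_split /left_right_split => pP [].
case: (e.2) pP => pP H1 H2; apply/asboolP/idP => [/pP|H]; try apply/pP; move: H1 H2; try move: H;
  by case: (w (m, n)); case: (w (m, n + 1)); case: (w (m + 1, n)); case: (w (m + 1, n + 1))
    => // _ _ [? [? ?]].
Qed.

Lemma phiE_opp l e : phi w l e = let f := edge_face l e in
  w (if e.2 then (f.1 + 1, f.2) else (f.1, f.2 + 1)) (+) w (f.1 + 1, f.2 + 1).
Proof.
rewrite phiE /=; have [] := Omega_face (edge_face_black l e).
case: (edge_face l e) => m n /=; case: e.2 => //.
by case: (w (m, n)); case: (w (m, n + 1)); case: (w (m + 1, n)); case: (w (m + 1, n + 1)).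
Qed.

Lemma phi_cross l l' e e' : edge_face l e = edge_face l' e' -> e.2 = ~~ e'.2 ->
  phi w l e -> phi w l' e' = false.
Proof.
move=> ff hh; rewrite !phiE -ff hh; have [_] := Omega_face (edge_face_black l e).
by case: (edge_face l e) => m n /=; case: e'.2 => /= + H; rewrite H ?andbT.
Qed.

(** A lattice vertex is the centre of a white face. Each of its four edges records the change of
    state along one side of this face, and the changes around the face cancel. *)
Lemma phi_even_deg l : even_deg (phi w l).
Proof.
move=> [a b]; rewrite (phiE l ((a, b), true)) (phiE_opp l ((a - 1, b), true)) /=.
rewrite (phiE l ((a, b), false)) (phiE_opp l ((a, b - 1), false)) /edge_face /=.
set d : int := if l then _ else _.
have -> : 2 * (a - 1) + d + 1 = 2 * a - 1 + d by lia.
have -> : 2 * (b - 1) + 1 + d + 1 = 2 * b + d by lia.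
have -> : 2 * b + d + 1 = 2 * b + 1 + d by lia.
have -> : 2 * a - 1 + d + 1 = 2 * a + d by lia.
by case: (w _); case: (w _); case: (w _); case: (w _).
Qed.

(* The unique vertex of L2 (for l = false), or of L1 with its index lowered by (1,1) (for
   l = true), at the centre of a face of G containing v. *)
Definition face_index (l : bool) (v : vertex) : vertex :=
  if l then (((v.1 - 1) %/ 2)%Z, ((v.2 - 2) %/ 2)%Z) else ((v.1 %/ 2)%Z, ((v.2 - 1) %/ 2)%Z).

(** The step from v to [v'] crosses e and no edge of the other lattice. The last clause locates e,
    for use with contours known only inside a ball. *)
Definition crossed (v v' : vertex) (l : bool) (e : edge) : Prop :=
  [/\ phi w l e = w v (+) w v',
      forall t, t (face_index l v) (+) t (face_index l v') = cobord t e,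
      face_index (~~ l) v = face_index (~~ l) v' & (norm e.1 <= (norm v).+2)%N].

Lemma crossed_right p q : exists l e, crossed (p, q) (p + 1, q) l e.
Proof.
have [ep|op] : (exists a, p = 2 * a) \/ (exists a, p = 2 * a - 1).
  by have [H|H] := boolP (odd `|p|); [right; exists ((p + 1) %/ 2)%Z|left; exists (p %/ 2)%Z]; lia.
  case: ep => a ->; exists true, ((a, (q %/ 2)%Z - 1), false); split.
  - have [eq|eq] : q = 2 * (q %/ 2)%Z \/ q = 2 * (q %/ 2)%Z + 1 by lia.
      rewrite phiE /= /edge_face /=; do 2![congr (w _ (+) w _) | congr pair]; lia.
    rewrite phiE_opp /= /edge_face /=; do 2![congr (w _ (+) w _) | congr pair]; lia.
  - move=> t; rewrite /cobord /face_index /= addbC; congr (t _ (+) t _); congr pair; lia.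
  - by rewrite /face_index /=; congr pair; lia.
  - by rewrite /norm /=; lia.
case: op => a ->; exists false, ((a, ((q - 1) %/ 2)%Z), false); split.
- have [eq|eq] : q = 2 * ((q - 1) %/ 2)%Z + 1 \/ q = 2 * ((q - 1) %/ 2)%Z + 2 by lia.
    rewrite phiE /= /edge_face /=; do 2![congr (w _ (+) w _) | congr pair]; lia.
  rewrite phiE_opp /= /edge_face /=; do 2![congr (w _ (+) w _) | congr pair]; lia.
- move=> t; rewrite /cobord /face_index /= addbC; congr (t _ (+) t _); congr pair; lia.
- by rewrite /face_index /=; congr pair; lia.
- by rewrite /norm /=; lia.
Qed.

Lemma crossed_up p q : exists l e, crossed (p, q) (p, q + 1) l e.
Proof.
have [eq|oq] : (exists b, q = 2 * b) \/ (exists b, q = 2 * b + 1).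
  by have [H|H] := boolP (odd `|q|); [right; exists ((q - 1) %/ 2)%Z|left; exists (q %/ 2)%Z]; lia.
  case: eq => b ->; exists false, (((p %/ 2)%Z, b), true); split.
  - have [ep|ep] : p = 2 * (p %/ 2)%Z \/ p = 2 * (p %/ 2)%Z + 1 by lia.
      rewrite phiE /= /edge_face /=; do 2![congr (w _ (+) w _) | congr pair]; lia.
    rewrite phiE_opp /= /edge_face /=; do 2![congr (w _ (+) w _) | congr pair]; lia.
  - move=> t; rewrite /cobord /face_index /= addbC; congr (t _ (+) t _); congr pair; lia.
  - by rewrite /face_index /=; congr pair; lia.
  - by rewrite /norm /=; lia.
case: oq => b ->; exists true, ((((p - 1) %/ 2)%Z, b), true); split.
- have [ep|ep] : p = 2 * ((p - 1) %/ 2)%Z + 1 \/ p = 2 * ((p - 1) %/ 2)%Z + 2 by lia.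
    rewrite phiE /= /edge_face /=; do 2![congr (w _ (+) w _) | congr pair]; lia.
  rewrite phiE_opp /= /edge_face /=; do 2![congr (w _ (+) w _) | congr pair]; lia.
- move=> t; rewrite /cobord /face_index /= addbC; congr (t _ (+) t _); congr pair; lia.
- by rewrite /face_index /=; congr pair; lia.
- by rewrite /norm /=; lia.
Qed.
End Constrained.

(** * Spins, charge and infinite clusters *)

Lemma grid_const (A : Type) (g : vertex -> A) (N : nat) :
  (forall p q : int, (norm (p, q) <= N)%N -> (norm (p + 1, q)%R <= N)%N -> g (p, q) = g (p + 1, q)) ->
  (forall p q : int, (norm (p, q) <= N)%N -> (norm (p, q + 1)%R <= N)%N -> g (p, q) = g (p, q + 1)) ->
  forall v v', (norm v <= N)%N -> (norm v' <= N)%N -> g v = g v'.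
Proof.
move=> gr gu [a b] [c d]; rewrite {1 2}/norm /= => vN vN'; transitivity (g (c, b)).
  apply: (line_const (f := fun k => g (k, b))) => k Hk.
  by have := gr (k - 1) b; rewrite subrK => -> //; rewrite /norm /=; lia.
apply: (line_const (f := fun k => g (c, k))) => k Hk.
by have := gu c (k - 1); rewrite subrK => -> //; rewrite /norm /=; lia.
Qed.

(** Each step of G changes w exactly when it changes the spin of the lattice whose edge it crosses,
    and leaves the other spin alone, so the sum of the three is a constant k. *)
Lemma spins w : Omega w -> exists k (s : bool -> vertex -> bool),
  (forall l, phi w l = cobord (s l)) /\
  forall v, w v = k (+) s false (face_index false v) (+) s true (face_index true v).
Proof.
move=> Ow; have [s sE] := choice (fun l => even_deg_exact (phi_even_deg Ow l)).
pose g v := w v (+) (s false (face_index false v) (+) s true (face_index true v)).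
have st v v' : (exists l e, crossed w v v' l e) -> g v = g v'.
  move=> [l [e [pe te fe _]]]; have := te (s l); rewrite -sE pe /g.
  case: l {pe te} fe => /= ->; case: (w v); case: (w v'); case: (s _ _); case: (s _ _);
    by case: (s _ _).
exists (g (0, 0)), s; split=> // v; rewrite -(@grid_const _ g (norm v) _ _ v) //.
- by rewrite /g; case: (w v); case: (s _ _); case: (s _ _).
- by move=> p q _ _; apply: st; exact: crossed_right.
- by move=> p q _ _; apply: st; exact: crossed_up.
Qed.

(* The product of the spins at x in L1 and y in L2: the first factor is the product of the spins at
   x and at the vertex of L2 with the same index, the second transports the latter to y. *)
Definition contour_charge (w : cfg) (x y : vertex) : bool :=
  w (2 * x.1, 2 * x.2 + 1) (+) prim (phi w false) x y.

Lemma contour_charge_theta w x y : contour_charge (theta w) x y = ~~ contour_charge w x y.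
Proof. by rewrite /contour_charge phi_theta /theta addNb. Qed.

Lemma contour_charge_translate i j w x y :
  contour_charge (translate (2 * i, 2 * j) w) (x.1 + i, x.2 + j) (y.1 + i, y.2 + j) = contour_charge w x y.
Proof.
rewrite /contour_charge /prim /= /translate /=; congr (w _ (+) (_ (+) _)).
- by congr pair; lia.
- rewrite -(seg_shift _ i x.1 y.1); congr seg; apply/funext => k.
  by rewrite phi_translate /= addrK.
- rewrite -(seg_shift _ j x.2 y.2); congr seg; apply/funext => k.
  by rewrite phi_translate /= addrK.
Qed.

(* Contours of the two lattices do not cross, so each of the two spin functions is constant
   along the contours of the other lattice. *)
Lemma contour_charge_const w x y x' y' : Omega w ->
  conn (adj (phi w false)) x x' -> conn (adj (phi w true)) y y' ->
  contour_charge w x y = contour_charge w x' y'.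
Proof.
move=> Ow xx' yy'; have [k [s [sE wE]]] := spins Ow.
(* The vertex u of the first lattice is the centre of the face of the second with index u - (1, 1);
   this is the source of the shift. *)
have chE u v : contour_charge w u v = k (+) s true (u.1 - 1, u.2 - 1) (+) s false v.
  rewrite /contour_charge sE prim_cobord wE /face_index /=.
  have -> : ((2 * u.1) %/ 2)%Z = u.1 by lia.
  have -> : ((2 * u.2 + 1 - 1) %/ 2)%Z = u.2 by lia.
  have -> : ((2 * u.1 - 1) %/ 2)%Z = u.1 - 1 by lia.
  have -> : ((2 * u.2 + 1 - 2) %/ 2)%Z = u.2 - 1 by lia.
  by case: u => a b; case: k {wE}; case: (s _ _); case: (s _ _); case: (s _ _).
rewrite !chE; congr (_ (+) _ (+) _).
  apply: (conn_invariant (f := fun u => s true (u.1 - 1, u.2 - 1))) xx' => u v /adjP.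
  suff H e : phi w false e -> s true (e.1.1 - 1, e.1.2 - 1) = s true ((tip e).1 - 1, (tip e).2 - 1).
    by case=> e /H He [[<- <-]|[<- <-]].
  case: e => -[a b] [] pe; rewrite /tip /=.
    have := @phi_cross w Ow false true ((a, b), true) ((a, b - 1), false).
    rewrite (sE true) /cobord /edge_face /= => H; apply/eqP; rewrite -negb_add addrK addbC H //.
    by congr pair; lia.
  have := @phi_cross w Ow false true ((a, b), false) ((a - 1, b), true).
  rewrite (sE true) /cobord /edge_face /= => H; apply/eqP; rewrite -negb_add addrK addbC H //.
  by congr pair; lia.
apply: (conn_invariant (f := s false)) yy' => u v /adjP.
suff H e : phi w true e -> s false e.1 = s false (tip e).
  by case=> e /H He [[<- <-]|[<- <-]].
case: e => -[a b] [] pe; rewrite /tip /=.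
  have := @phi_cross w Ow true false ((a, b), true) ((a + 1, b), false).
  rewrite (sE false) /cobord /edge_face /= => H; apply/eqP; rewrite -negb_add addbC -[a in X in _ (+) X](addrK 1).
  by rewrite H //; congr pair; lia.
have := @phi_cross w Ow true false ((a, b), false) ((a, b + 1), true).
rewrite (sE false) /cobord /edge_face /= => H; apply/eqP; rewrite -negb_add addbC -[b in X in _ (+) X](addrK 1).
by rewrite H //; congr pair; lia.
Qed.

(** Only the contours meeting the ball of radius m are kept. They are finite in number and in size,
    so their spin function is constant far away and can be normalised to vanish there. *)
Lemma bounded_primitive (psi : ecfg) m : even_deg psi ->
  (forall x, ~ unbounded (adj psi) x) ->
  exists t N, [/\ forall y, (N <= norm y)%N -> t y = false,
    forall e, (norm e.1 <= m)%N -> cobord t e = psi e &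
    forall e, psi e = false -> cobord t e = false].
Proof.
move=> ev bd.
have [f fP] : {f : vertex -> nat & forall x y, conn (adj psi) x y -> (norm y < f x)%N}.
  apply: (@choice _ _ (fun x n => forall y, conn (adj psi) x y -> (norm y < n)%N)) => x.
  apply: contrapT => nb; apply: (bd x) => M; apply: contrapT => ny; apply: nb; exists M => y xy.
  by rewrite ltnNge; apply/negP => My; apply: ny; exists y.
pose S x := `[< exists2 x0, (norm x0 <= m)%N & conn (adj psi) x0 x >].
pose M := \max_(x <- ball_seq m) f x.
have SM x : S x -> (norm x < M)%N.
  move=> /asboolP[x0 x0m x0x]; apply: (leq_trans (fP _ _ x0x)).
  by apply: leq_bigmax_seq; rewrite ?mem_ball_seq.
have Sadj x y : adj psi x y -> S x = S y.
  move=> xy; apply/asboolP/asboolP => -[x0 x0m c]; exists x0 => //; apply: (conn_trans c).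
    exact: conn1.
  by apply: conn1; rewrite adj_sym.
(* Contours are kept or dropped as a whole, which preserves even degrees. *)
pose psi' : ecfg := fun e => psi e && S e.1.
have [s sE] : exists s, psi' = cobord s.
  apply: even_deg_exact => -[a b]; rewrite /psi' /=.
  have -> : psi ((a - 1, b), true) && S (a - 1, b) = psi ((a - 1, b), true) && S (a, b).
    case E: (psi _) => //=; apply: Sadj; have := adj_edge E.
    by rewrite /tip /= subrK.
  have -> : psi ((a, b - 1), false) && S (a, b - 1) = psi ((a, b - 1), false) && S (a, b).
    case E: (psi _) => //=; apply: Sadj; have := adj_edge E.
    by rewrite /tip /= subrK.
  by have := ev (a, b) => /=; case: (S (a, b)); rewrite ?andbT ?andbF.
have far e : (M <= norm e.1)%N -> cobord s e = false.
  by rewrite -sE /psi' => Me; case E: (S _); rewrite ?andbF //; have := leq_trans (SM _ E) Me; rewrite ltnn.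
(* No kept edge has base of norm M or more, so s is constant along far rows and far columns; these
   link every far point to (M, M). *)
have farH a c b : (M <= `|b|)%N -> s (a, b) = s (c, b).
  move=> Mb; apply: (line_const (f := fun k => s (k, b))) => k _.
  have /= := far ((k, b), false); rewrite /cobord /norm /= => H; apply/eqP; rewrite -negb_add H //.
  by rewrite leq_max Mb orbT.
have farV a b c : (M <= `|a|)%N -> s (a, b) = s (a, c).
  move=> Ma; apply: (line_const (f := fun k => s (a, k))) => k _.
  have /= := far ((a, k), true); rewrite /cobord /norm /= => H; apply/eqP; rewrite -negb_add H //.
  by rewrite leq_max Ma.
have farE y : (M <= norm y)%N -> s y = s (M%:Z, M%:Z).
  case: y => a b; rewrite /norm leq_max => /orP[Ma|Mb].
    by rewrite (farV a b M%:Z) // (farH a M%:Z).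
  by rewrite (farH a M%:Z) // (farV M%:Z b M%:Z).
pose t y := s y (+) s (M%:Z, M%:Z).
have tE e : cobord t e = psi' e.
  by rewrite sE /cobord /t; case: (s e.1); case: (s _); case: (s _).
exists t, M; split=> [y /farE yE|e em|e pe]; first by rewrite /t yE addbb.
  rewrite tE /psi' (_ : S e.1) ?andbT //; apply/asboolP.
  by exists e.1 => //; exact: conn0.
by rewrite tE /psi' pe.
Qed.

Definition same_state (w : cfg) : rel vertex := fun u v =>
  (`|u.1 - v.1| + `|u.2 - v.2| == 1) && (w u == w v).

Definition infinite_color (b : bool) (w : cfg) : Prop :=
  exists2 v, w v = b & unbounded (same_state w) v.

(** A step that keeps the state crosses an absent edge, and t changes only across present ones. *)
Lemma same_state_face_index w (t : bool -> vertex -> bool) u v : Omega w ->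
  (forall l e, phi w l e = false -> cobord (t l) e = false) ->
  same_state w u v -> forall l, t l (face_index l u) = t l (face_index l v).
Proof.
move=> Ow tp; have key v1 v2 : (exists l e, crossed w v1 v2 l e) -> w v1 = w v2 ->
    forall l, t l (face_index l v1) = t l (face_index l v2).
  move=> [l [e [pe te fe _]]] w12 l'; rewrite w12 addbb in pe.
  have [->|l'l] := eqVneq l' l; first by apply/eqP; rewrite -negb_add te tp.
  have -> : l' = ~~ l by case: (l) (l') l'l => -[].
  by rewrite fe.
case: u v => a b [c d] /andP[/eqP /= ad /eqP wE].
have [[e1 e2]|[[e1 e2]|[[e1 e2]|[e1 e2]]]] : (c = a + 1 /\ d = b) \/ (a = c + 1 /\ d = b) \/
   (c = a /\ d = b + 1) \/ (c = a /\ b = d + 1) by lia.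
- by subst; apply: key => //; exact: crossed_right.
- by subst => l; symmetry; apply: key => //; exact: crossed_right.
- by subst; apply: key => //; exact: crossed_up.
- by subst => l; symmetry; apply: key => //; exact: crossed_up.
Qed.

(** Flipping one side of the contours near u and v adds to w the spins [t], which vanish on infinite
    clusters. The sum is constant on a ball containing u and v, so w would agree at u and v. *)
Lemma infinite_color_contour w : Omega w -> (forall l x, ~ unbounded (adj (phi w l)) x) ->
  infinite_color true w -> infinite_color false w -> False.
Proof.
move=> Ow bd [u wu uu] [v wv uv]; pose R := maxn (norm u) (norm v).
(* A step from a point of norm at most R crosses an edge based within R + 2. *)
have [t tP] := choice (fun l => bounded_primitive R.+2 (phi_even_deg Ow l) (bd l)).
have [N NP] := choice tP.
have tz l y : (N l <= norm y)%N -> t l y = false by case: (NP l) => + _ _; apply.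
have tp l e : (norm e.1 <= R.+2)%N -> cobord (t l) e = phi w l e by case: (NP l) => _ + _; apply.
have tq l e : phi w l e = false -> cobord (t l) e = false by case: (NP l) => _ _; apply.
have t_inf x l : unbounded (same_state w) x -> t l (face_index l x) = false.
  (* [face_index] roughly halves coordinates, so this radius puts the index of y where [t l]
     vanishes. *)
  move=> /(_ (2 * N l + 4)%N)[y xy yN].
  rewrite (conn_invariant (f := fun x => t l (face_index l x)) _ xy) => [|x1 x2 x12].
    by apply: tz; move: (N l) yN => M; rewrite /norm /face_index; case: l => /=; lia.
  exact: (same_state_face_index Ow tq x12 l).
pose g x := w x (+) (t false (face_index false x) (+) t true (face_index true x)).
have st x x' : (norm x <= R)%N -> (exists l e, crossed w x x' l e) -> g x = g x'.
  move=> xR [l [e [pe te fe ne]]]; have := te (t l); rewrite tp; last by apply: (leq_trans ne); lia.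
  rewrite pe /g; case: l {pe te} fe => /= ->; case: (w x); case: (w x'); case: (t _ _);
    case: (t _ _); by case: (t _ _).
have : g u = g v.
  apply: (@grid_const _ g R); try by rewrite /R; lia.
    by move=> p q pR _; apply: st => //; exact: crossed_right.
  by move=> p q pR _; apply: st => //; exact: crossed_up.
by rewrite /g !t_inf // wu wv.
Qed.

(** * Measurability *)

Section MeasurablePredicates.
Context {d : measure_display} {T : measurableType d}.
Implicit Types P Q : T -> Prop.

Definition mpred P := measurable [set t | P t].

Lemma mpred_eq P Q : (forall t, P t <-> Q t) -> mpred P -> mpred Q.
Proof. by move=> PQ; rewrite /mpred; congr measurable; apply/seteqP; split=> t /PQ. Qed.

Lemma mpred_cst (P : Prop) : mpred (fun=> P).
Proof.
by have [p|np] := pselect P; [apply: mpred_eq measurableT|apply: mpred_eq measurable0].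
Qed.

Lemma mpred_not P : mpred P -> mpred (fun t => ~ P t).
Proof. exact: measurableC. Qed.

Lemma mpred_and P Q : mpred P -> mpred Q -> mpred (fun t => P t /\ Q t).
Proof. exact: measurableI. Qed.

Lemma mpred_or P Q : mpred P -> mpred Q -> mpred (fun t => P t \/ Q t).
Proof. exact: measurableU. Qed.

Lemma mpred_imply P Q : mpred P -> mpred Q -> mpred (fun t => P t -> Q t).
Proof.
move=> mP mQ; apply: mpred_eq (mpred_or (mpred_not mP) mQ) => t.
by split=> [[nP /nP|q _]//|PQ]; have [/PQ|] := pselect (P t); [right|left].
Qed.

Lemma mpred_exists (I : countType) (P : I -> T -> Prop) :
  (forall i, mpred (P i)) -> mpred (fun t => exists i, P i t).
Proof.
move=> mP; have := countable_bigcupT_measurable (countableP [set: I]) mP.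
by apply: mpred_eq => t; split=> [[i _ Pi]|[i Pi]]; exists i.
Qed.

Lemma mpred_exists2 (I : countType) (P Q : I -> T -> Prop) :
  (forall i, mpred (P i)) -> (forall i, mpred (Q i)) -> mpred (fun t => exists2 i, P i t & Q i t).
Proof.
move=> mP mQ; apply: mpred_eq (mpred_exists (fun i => mpred_and (mP i) (mQ i))) => t.
by split=> -[i]; [case|move=> p q]; exists i.
Qed.

Lemma mpred_forall (I : countType) (P : I -> T -> Prop) :
  (forall i, mpred (P i)) -> mpred (fun t => forall i, P i t).
Proof.
move=> mP; have := mpred_not (mpred_exists (fun i => mpred_not (mP i))).
by apply: mpred_eq => t; split=> [nP i|P' [i]//]; apply: contrapT => nPi; apply: nP; exists i.
Qed.

Definition mbool (f : T -> bool) := mpred f.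

Lemma mbool_cst b : mbool (fun=> b). Proof. exact: mpred_cst. Qed.

Lemma mbool_neg f : mbool f -> mbool (fun t => ~~ f t).
Proof. by move=> /mpred_not; apply: mpred_eq => t; split=> /negP. Qed.

Lemma mbool_and f g : mbool f -> mbool g -> mbool (fun t => f t && g t).
Proof. by move=> mf mg; apply: mpred_eq (mpred_and mf mg) => t; split=> /andP. Qed.

Lemma mbool_or f g : mbool f -> mbool g -> mbool (fun t => f t || g t).
Proof. by move=> mf mg; apply: mpred_eq (mpred_or mf mg) => t; split=> /orP. Qed.

Lemma mbool_addb f g : mbool f -> mbool g -> mbool (fun t => f t (+) g t).
Proof.
move=> mf mg; have := mbool_or (mbool_and mf (mbool_neg mg)) (mbool_and (mbool_neg mf) mg).
by apply: mpred_eq => t; case: (f t); case: (g t).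
Qed.

Lemma mbool_eq f g : mbool f -> mbool g -> mpred (fun t => f t = g t).
Proof.
move=> mf mg; apply: mpred_eq (mbool_neg (mbool_addb mf mg)) => t.
by case: (f t); case: (g t).
Qed.

Lemma mbool_seg (g : T -> int -> bool) a b :
  (forall i, mbool (fun t => g t i)) -> mbool (fun t => seg (g t) a b).
Proof.
move=> mg; rewrite /seg; set c := Num.min a b; elim: `|b - a|%N => [|n IH].
  by apply: mpred_eq (mbool_cst false) => t; rewrite big_ord0.
by apply: mpred_eq (mbool_addb IH (mg (c + n%:Z + 1))) => t; rewrite big_ord_recr.
Qed.

Lemma mpred_conn (X : countType) (e : T -> rel X) x y :
  (forall u v, mbool (fun t => e t u v)) -> mpred (fun t => conn (e t) x y).
Proof.
move=> me; apply: mpred_exists2 => p; last exact: mpred_cst.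
elim: p x => [|z p IH] x; first exact: mbool_cst.
exact: mbool_and (me x z) (IH z).
Qed.

Lemma mpred_unbounded (e : T -> rel vertex) x :
  (forall u v, mbool (fun t => e t u v)) -> mpred (fun t => unbounded (e t) x).
Proof.
move=> me; apply: mpred_forall => m; apply: mpred_exists2 => y; last exact: mpred_cst.
exact: mpred_conn.
Qed.

Lemma mbool_adj (psi : T -> ecfg) u v :
  (forall e, mbool (fun t => psi t e)) -> mbool (fun t => adj (psi t) u v).
Proof.
by move=> mp; rewrite /adj /=; do 4?[apply: mbool_or]; try exact: mbool_cst;
  apply: mbool_and => //; exact: mbool_cst.
Qed.

Lemma mpred_two_infinite (psi : T -> ecfg) :
  (forall e, mbool (fun t => psi t e)) -> mpred (fun t => two_infinite (psi t)).
Proof.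
move=> mp; have ma u v := mbool_adj u v mp.
apply: mpred_exists => x; apply: mpred_exists => y.
have := mpred_and (mpred_and (mpred_unbounded x ma) (mpred_unbounded y ma))
  (mpred_not (mpred_conn x y ma)).
by apply: mpred_eq => t; split=> [[[]]|[]].
Qed.

Lemma mpred_trifurcation (psi : T -> ecfg) n z :
  (forall e, mbool (fun t => psi t e)) -> mpred (fun t => trifurcation n z (psi t)).
Proof.
move=> mp; have ma u v := mbool_adj u v mp; pose K := box n z.
have mport u : mpred (fun t => port K (adj (psi t)) u).
  by apply: mpred_and (mpred_cst _) _; apply: mpred_exists2 => v;
    [exact: mpred_cst|exact: ma].
have mo u v : mbool (fun t => outside K (adj (psi t)) u v).
  exact: mbool_and (ma u v) (mbool_cst _).
have mi u v : mbool (fun t => inside K (adj (psi t)) u v).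
  exact: mbool_and (ma u v) (mbool_cst _).
have mbr x : mpred (fun t => branch K (adj (psi t)) x).
  have := mpred_and (mpred_and (mpred_cst (~~ K x))
    (mpred_exists2 (fun k => mpred_cst (K k)) (fun k => ma k x))) (mpred_unbounded x mo).
  by apply: mpred_eq => t; split=> [[[]]|[]].
apply: mpred_and.
  apply: mpred_forall => u; apply: mpred_forall => v; do 2!apply: mpred_imply => //.
  exact: mpred_conn.
apply: mpred_exists => x; apply: mpred_exists => y; apply: mpred_exists => v.
apply: mpred_and.
  have := mpred_and (mpred_and (mbr x) (mbr y)) (mbr v).
  by apply: mpred_eq => t; split=> [[[]]|[]].
have mc u u' := mpred_not (mpred_conn u u' mo).
have := mpred_and (mpred_and (mc x y) (mc x v)) (mc y v).
by apply: mpred_eq => t; split=> [[[]]|[]].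
Qed.
End MeasurablePredicates.

Lemma mpred_preimage d d' (T : measurableType d) (U : measurableType d') (f : T -> U)
  (P : U -> Prop) : measurable_fun setT f -> mpred P -> mpred (fun t => P (f t)).
Proof. by move=> mf mP; have := mf measurableT _ mP; rewrite setTI. Qed.

Lemma mbool_state (v : vertex) : mbool (fun w : Cfg => w v).
Proof. by apply: sub_sigma_algebra; exists v, true. Qed.

Lemma mbool_edge (e : edge) : mbool (fun psi : ECfg => psi e).
Proof. by apply: sub_sigma_algebra; exists e, true. Qed.

Lemma mbool_phi l e : mbool (fun w : Cfg => phi w l e).
Proof.
have ms u v : mpred (fun w : Cfg => w u = w v) by apply: mbool_eq; exact: mbool_state.
suff : mpred (fun w : Cfg => present w l e) by apply: mpred_eq => w; split=> /asboolP.
apply: mpred_exists => m; apply: mpred_exists => n.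
do 2![apply: mpred_and; first exact: mpred_cst].
apply: mpred_or; (apply: mpred_and; first exact: mpred_cst);
  do 2![apply: mpred_and; first exact: ms]; exact: mpred_not.
Qed.

Lemma measurable_to_cfg d (T : measurableType d) (f : T -> Cfg) :
  (forall v, mbool (fun t => f t v)) -> measurable_fun setT f.
Proof.
move=> mf; apply: (@measurability _ _ T Cfg setT f cfg_cylinders) => // _ [_ [v [b ->]] <-]; rewrite setTI.
exact: (mbool_eq (mf v) (mbool_cst b)).
Qed.

Lemma measurable_to_ecfg d (T : measurableType d) (f : T -> ECfg) :
  (forall v, mbool (fun t => f t v)) -> measurable_fun setT f.
Proof.
move=> mf; apply: (@measurability _ _ T ECfg setT f ecfg_cylinders) => // _ [_ [v [b ->]] <-]; rewrite setTI.
exact: (mbool_eq (mf v) (mbool_cst b)).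
Qed.

Lemma mpred_Omega : mpred (fun w : Cfg => Omega w).
Proof.
apply: mpred_forall => m; apply: mpred_forall => n; apply: mpred_imply; first exact: mpred_cst.
have mst v b : mpred (fun w : Cfg => w v = b) := mbool_eq (mbool_state v) (mbool_cst b).
have key a b c d : mbool (fun w : Cfg => (a, b, c, d) == face_states w m n).
  have := mpred_and (mpred_and (mst (m, n) a) (mst (m, n + 1) b))
    (mpred_and (mst (m + 1, n + 1) c) (mst (m + 1, n) d)).
  apply: mpred_eq => w; rewrite eq_sym /face_states !xpair_eqE -!andbA; split.
    by move=> [[-> ->] [-> ->]]; rewrite !eqxx.
  by case/and4P => /eqP-> /eqP-> /eqP-> /eqP->.
suff : mbool (fun w : Cfg => has (pred1 (face_states w m n)) allowed_patterns).
  by apply: mpred_eq => w; rewrite has_pred1.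
rewrite /allowed_patterns /=; do 6?[apply: mbool_or]; try exact: mbool_cst;
  exact: key.
Qed.

(** * Translations *)

Lemma conn_map (X Y : Type) (e : rel X) (e' : rel Y) (f : X -> Y) x y :
  (forall u v, e u v -> e' (f u) (f v)) -> conn e x y -> conn e' (f x) (f y).
Proof.
move=> ee'; move: x; apply: conn_ind => [|x z /ee' exz _]; first exact: conn0.
exact/conn_trans/conn1.
Qed.

Section GridIsomorphism.
Variables (e e' : rel vertex) (f g : vertex -> vertex) (K K' : pred vertex) (c : nat).
Hypotheses (ee' : forall u v, e' (f u) (f v) = e u v) (KK' : forall u, K' (f u) = K u).
Hypotheses (fK : cancel f g) (gK : cancel g f) (fc : forall u, (norm u <= norm (f u) + c)%N).

Lemma conn_iso x y : conn e' (f x) (f y) <-> conn e x y.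
Proof.
split; last by apply: conn_map => u v; rewrite ee'.
by move=> /(@conn_map _ _ e' e g); rewrite !fK; apply=> u v; rewrite -ee' !gK.
Qed.

Lemma unbounded_iso x : unbounded e x -> unbounded e' (f x).
Proof.
move=> ux m; have [y xy my] := ux (m + c)%N; exists (f y); first exact/conn_iso.
by have := fc y; lia.
Qed.

Lemma outside_iso u v : outside K' e' (f u) (f v) = outside K e u v.
Proof. by rewrite /outside ee' !KK'. Qed.

Lemma inside_iso u v : inside K' e' (f u) (f v) = inside K e u v.
Proof. by rewrite /inside ee' !KK'. Qed.

Lemma port_iso u : port K' e' (f u) -> port K e u.
Proof.
move=> [Ku [v Kv uv]]; split; first by rewrite -KK'.
by exists (g v); rewrite -?ee' -?KK' gK.
Qed.
End GridIsomorphism.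

Definition shift_edges (t : vertex) (psi : ecfg) : ecfg :=
  fun e => psi ((e.1.1 - t.1, e.1.2 - t.2), e.2).

Lemma shift_edgesK i j psi : shift_edges (- i, - j) (shift_edges (i, j) psi) = psi.
Proof. by apply/funext => -[[a b] h]; rewrite /shift_edges /= !opprK !addrK. Qed.

Lemma adj_shift t psi u v :
  adj (shift_edges t psi) (u.1 + t.1, u.2 + t.2) (v.1 + t.1, v.2 + t.2) = adj psi u v.
Proof.
case: t u v => i j [a b] [c d] /=; apply/adjP/adjP => -[[[k l] h] /= pe H].
  exists ((k - i, l - j), h) => //; move: H; rewrite /tip /=.
  by case: h {pe} => -[[[? ?] [? ?]]|[[? ?] [? ?]]]; [left|right|left|right];
    split; congr pair; lia.
exists ((k + i, l + j), h); first by rewrite /shift_edges /= !addrK.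
move: H; rewrite /tip /=.
by case: h {pe} => -[[[? ?] [? ?]]|[[? ?] [? ?]]]; [left|right|left|right];
  split; congr pair; lia.
Qed.

Lemma conn_shift t psi x y : conn (adj (shift_edges t psi)) (x.1 + t.1, x.2 + t.2) (y.1 + t.1, y.2 + t.2)
  <-> conn (adj psi) x y.
Proof.
apply: (@conn_iso _ _ (fun u => (u.1 + t.1, u.2 + t.2)) (fun u => (u.1 - t.1, u.2 - t.2))).
- exact: adj_shift.
- by move=> [a b] /=; rewrite !addrK.
- by move=> [a b] /=; rewrite !subrK.
Qed.

Lemma norm_shift (t u : vertex) : (norm u <= norm (u.1 + t.1, u.2 + t.2)%R + norm t)%N.
Proof. by rewrite /norm /=; lia. Qed.

Lemma unbounded_shift t psi x :
  unbounded (adj psi) x -> unbounded (adj (shift_edges t psi)) (x.1 + t.1, x.2 + t.2).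
Proof.
apply: (@unbounded_iso _ _ (fun u => (u.1 + t.1, u.2 + t.2)) (fun u => (u.1 - t.1, u.2 - t.2)) (norm t)).
- exact: adj_shift.
- by move=> [a b] /=; rewrite !addrK.
- by move=> [a b] /=; rewrite !subrK.
- exact: norm_shift.
Qed.

Lemma two_infinite_shift t psi : two_infinite psi -> two_infinite (shift_edges t psi).
Proof.
move=> [x [y [ux uy nxy]]]; exists (x.1 + t.1, x.2 + t.2), (y.1 + t.1, y.2 + t.2).
split; [exact: unbounded_shift|exact: unbounded_shift|].
by rewrite conn_shift.
Qed.

Lemma trifurcation_shift n z t psi :
  trifurcation n z psi -> trifurcation n (z.1 + t.1, z.2 + t.2) (shift_edges t psi).
Proof.
pose f (u : vertex) : vertex := (u.1 + t.1, u.2 + t.2).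
pose g (u : vertex) : vertex := (u.1 - t.1, u.2 - t.2).
have fK : cancel f g by move=> [a b]; rewrite /f /g /= !addrK.
have gK : cancel g f by move=> [a b]; rewrite /f /g /= !subrK.
have ee' u v : adj (shift_edges t psi) (f u) (f v) = adj psi u v by exact: adj_shift.
have fc u : (norm u <= norm (f u) + norm t)%N by exact: norm_shift.
rewrite -/(f z) => -[inn [x [y [w [[bx by_ bw] [nxy nxw nyw]]]]]].
have KK' u : box n (f z) (f u) = box n z u by rewrite /box /f /=; congr (norm _ <= _)%N; congr pair; lia.
have oo' := outside_iso ee' KK'; have ii' := inside_iso ee' KK'.
split=> [u v pu pv|].
  rewrite -(gK u) -(gK v); apply/(conn_iso ii' fK gK); apply: inn.
    by apply: (port_iso ee' KK' gK); rewrite gK.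
  by apply: (port_iso ee' KK' gK); rewrite gK.
have bb' v : branch (box n z) (adj psi) v -> branch (box n (f z)) (adj (shift_edges t psi)) (f v).
  move=> [Kv [k Kk kv] uv]; split; first by rewrite KK'.
    by exists (f k); rewrite ?KK' ?ee'.
  exact: (unbounded_iso oo' fK gK fc).
exists (f x), (f y), (f w); split; first by split; exact: bb'.
by split; rewrite (conn_iso oo' fK gK).
Qed.

(** The left side is the expected number of the events that occur. *)
Lemma sum_measure_le {R : realType} d (T : measurableType d) (mu : probability T R) (I : Type)
    (P : I -> T -> Prop) (s : seq I) m : (forall i, mpred (P i)) ->
  (forall t, (count (fun i => `[< P i t >]) s <= m)%N) ->
  (\sum_(i <- s) mu [set t | P i t] <= (m%:R)%:E)%E.
Proof.
move=> mP cm; have E i : mu [set t | P i t] = (\int[mu]_t (\1_[set t | P i t] t)%:E)%E.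
  by rewrite integral_indic ?setIT //; exact: mP.
rewrite (eq_bigr _ (fun i _ => E i)) -ge0_integral_sum //; last first.
  by move=> i; apply/measurable_EFinP; exact: (measurable_indic (mP i)).
have <- : (\int[mu]_t (cst (m%:R)%:E t) = (m%:R)%:E)%E.
  by rewrite integral_cst // [X in (_ * X)%E](_ : _ = 1%E) ?mule1 //; exact: probability_setT.
apply: ge0_le_integral => //.
- by move=> t _; apply: sume_ge0 => i _; rewrite lee_fin.
- by apply: emeasurable_sum => i; apply/measurable_EFinP; exact: (measurable_indic (mP i)).
move=> t _; rewrite sumEFin lee_fin; have -> : \sum_(i <- s) \1_[set t | P i t] t =
    (count (fun i => `[< P i t >]) s)%:R :> R.
  elim: s {cm} => [|i s IH]; first by rewrite big_nil.
  by rewrite big_cons IH /= natrD indicE; congr (_%:R + _).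
by rewrite ler_nat.
Qed.

(** * Probability *)

Section Assembly.
Variables (R : realType) (mu : probability Cfg R).
Hypothesis muO : mu Omega = 1%E.
Hypothesis A1 : forall (i j : int) (A : set Cfg), measurable A ->
  mu (translate (i + j, i - j) @^-1` A) = mu A.
Hypothesis A2 : forall A : set Cfg, measurable A ->
  (forall i j : int, translate (2 * i, 2 * j) @^-1` A = A) -> mu A = 0%E \/ mu A = 1%E.
Hypothesis A3 : forall A : set Cfg, measurable A -> mu (theta @^-1` A) = mu A.
Hypothesis A4 : forall (S : int * int) (E : set ECfg), measurable E ->
  (0 < pushforward mu phi1 E)%E -> (0 < pushforward mu phi1 (flip_face S @` E))%E.

Definition null (P : Cfg -> Prop) := mu.-negligible [set w | P w].

Lemma nullP P : mpred P -> null P <-> mu [set w | P w] = 0%E.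
Proof. exact: negligibleP. Qed.

Lemma null_sub P Q : (forall w, P w -> Q w) -> null Q -> null P.
Proof. by move=> PQ; apply: negligibleS => w /PQ. Qed.

Lemma null_or P Q : null P -> null Q -> null (fun w => P w \/ Q w).
Proof. exact: negligibleU. Qed.

Lemma null_exists (I : countType) (P : I -> Cfg -> Prop) :
  (forall i, null (P i)) -> null (fun w => exists i, P i w).
Proof.
move=> nP; pose F k := [set w | if @unpickle I k is Some i then P i w else False].
apply: (@negligibleS _ _ _ _ (\bigcup_k F k)) => [w [i Piw]|].
  by exists (pickle i) => //; rewrite /F /= pickleK.
apply: negligible_bigcup => k; rewrite /F; case: (unpickle k) => [i|]; first exact: nP.
exact: negligible_set0.
Qed.

Lemma not_null_True : ~ null (fun=> True).
Proof.
by move=> /(nullP (mpred_cst True)); rewrite (probability_setT mu) => -[] /eqP; rewrite oner_eq0.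
Qed.

Lemma null_not P : mpred P -> mu [set w | P w] = 1%E -> null (fun w => ~ P w).
Proof.
move=> mP P1; apply/(nullP (mpred_not mP)).
by have := probability_setC mu mP; rewrite P1 subee.
Qed.

Lemma null_Omega : null (fun w => ~ Omega w).
Proof. by apply: null_not muO; exact: mpred_Omega. Qed.

Lemma translateK i j (w : Cfg) : translate (2 * i, 2 * j) (translate (2 * - i, 2 * - j) w) = w.
Proof. by apply/funext => -[a b]; rewrite /translate /=; congr (w _); congr pair; lia. Qed.

Lemma zero_one (P : Cfg -> Prop) : mpred P ->
  (forall i j w, P w -> P (translate (2 * i, 2 * j) w)) -> null P \/ null (fun w => ~ P w).
Proof.
move=> mP Pt; have [||P0|P1] := @A2 [set w | P w].
- exact: mP.
- move=> i j; apply/seteqP; split=> w /=; last exact: Pt.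
  by move=> /(Pt (- i) (- j)); have := translateK (- i) (- j) w; rewrite !opprK => ->.
- by left; apply/(nullP mP).
- by right; exact: null_not.
Qed.

Lemma null_theta P : mpred P -> null P -> null (fun w => P (theta w)).
Proof.
move=> mP; have mt : measurable_fun setT theta.
  by apply: measurable_to_cfg => v; apply: mbool_neg; exact: mbool_state.
by move=> /(nullP mP) P0; apply/(nullP (mpred_preimage mt mP)); rewrite -P0 -(A3 mP).
Qed.

Lemma measure_dual (Q : ecfg -> Prop) : (forall l, mpred (fun w : Cfg => Q (phi w l))) ->
  mu [set w | Q (phi w true)] = mu [set w | Q (phi w false)].
Proof.
move=> mQ; rewrite -(A1 1 0 (mQ true)); congr (mu _); apply/seteqP.
by split=> w /=; have -> : phi (translate (1 + 0, 1 - 0) w) true = phi w false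
  by apply/funext => e; rewrite addr0 phi_dual.
Qed.

Lemma null_dual (Q : ecfg -> Prop) : (forall l, mpred (fun w : Cfg => Q (phi w l))) ->
  null (fun w => Q (phi w false)) -> forall l, null (fun w => Q (phi w l)).
Proof.
by move=> mQ /(nullP (mQ false)) Q0 [//|]; apply/(nullP (mQ _)) => //; rewrite measure_dual.
Qed.

Lemma phi_shift i j w l : phi (translate (2 * i, 2 * j) w) l = shift_edges (i, j) (phi w l).
Proof. by apply/funext => e; rewrite phi_translate. Qed.

Lemma measure_shift i j (Q : ecfg -> Prop) : mpred (fun w : Cfg => Q (phi w false)) ->
  mu [set w | Q (shift_edges (i, j) (phi w false))] = mu [set w | Q (phi w false)].
Proof.
move=> mQ; rewrite -(A1 (i + j) (i - j) mQ); congr (mu _); apply/funext => w /=.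
have -> : (i + j + (i - j), i + j - (i - j)) = (2 * i, 2 * j) by congr pair; lia.
by rewrite phi_shift.
Qed.

(** * Finite energy and uniqueness of infinite contours *)

Lemma phi_mpred (Q : ecfg -> Prop) l :
  mpred (fun psi : ECfg => Q psi) -> mpred (fun w : Cfg => Q (phi w l)).
Proof.
move=> mQ; apply: (@mpred_preimage _ _ _ _ (fun w : Cfg => phi w l : ECfg) Q _ mQ).
by apply: measurable_to_ecfg => e; exact: mbool_phi.
Qed.

(** This is the contrapositive of finite energy, one face at a time: flipping is an involution, so
    the event Q is the image under the flip of the event that Q holds after the flip. *)
Lemma null_flips (Q : ecfg -> Prop) F : mpred (fun psi : ECfg => Q psi) ->
  null (fun w => Q (phi w false)) -> null (fun w => Q (foldr flip_face (phi w false) F)).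
Proof.
elim: F Q => [//|S F IH] Q mQ Q0 /=.
have mS : mpred (fun psi : ECfg => Q (flip_face S psi)).
  apply: (@mpred_preimage _ _ _ _ (flip_face S : ECfg -> ECfg) Q _ mQ).
  apply: measurable_to_ecfg => e; rewrite /flip_face; case: `[< side_of S e >]; last exact: mbool_edge.
  by apply: mbool_neg; exact: mbool_edge.
apply: (IH (fun psi => Q (flip_face S psi))) => //.
apply/(nullP (phi_mpred false mS)); apply/eqP; rewrite eq_le measure_ge0 andbT leNgt; apply/negP.
move=> /(A4 S mS); have -> : flip_face S @` [set psi | Q (flip_face S psi)] = [set psi | Q psi].
  apply/seteqP; split=> [_ [psi Qp <-]//|psi Qp]; exists (flip_face S psi); last exact: flip_faceK.
  by rewrite /= flip_faceK.
by move: Q0 => /(nullP (phi_mpred false mQ)); rewrite /pushforward /phi1 => ->; rewrite ltxx.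
Qed.

Lemma null_rewired (P : Cfg -> Prop) (Q : ecfg -> Prop) : mpred (fun psi : ECfg => Q psi) ->
  null (fun w => Q (phi w false)) ->
  (forall w, Omega w -> P w -> exists F, Q (foldr flip_face (phi w false) F)) -> null P.
Proof.
move=> mQ Q0 PQ; apply: (null_sub _ (null_or null_Omega (null_exists (fun F => null_flips F mQ Q0)))).
by move=> w Pw; have [Ow|] := pselect (Omega w); [right; exact: PQ|left].
Qed.

(** By translation invariance the expected number of trifurcations among M * M disjoint boxes is M *
    M * p, whereas the count is at most linear in M. *)
Lemma trifurcation_null n : null (fun w => trifurcation n (0, 0) (phi w false)).
Proof.
have mt z : mpred (fun w : Cfg => trifurcation n z (phi w false)).
  by apply: mpred_trifurcation => e; exact: mbool_phi.
apply/(nullP (mt _)); set p := mu _.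
have pz z : mu [set w | trifurcation n z (phi w false)] = p.
  case: z => i j; rewrite /p -(measure_shift i j (mt _)); congr (mu _); apply/seteqP.
  split=> w /= H; last by have := trifurcation_shift (i, j) H; rewrite /= !add0r.
  by have := trifurcation_shift (- i, - j) H; rewrite shift_edgesK /= !subrr.
(* With N as below and M positive, 2 * N + 1 = (4 * n + 2) * M + 2 * n + 3 is at most (6 * n + 5) *
   M. *)
pose K := (4 * (6 * n + 5))%N.
have sump (s : seq vertex) : (\sum_(z <- s) p = (size s)%:R%:E * p)%E.
  elim: s => [|z s IH]; first by rewrite big_nil mul0e.
  by rewrite big_cons IH /= -add1n natrD EFinD ge0_muleDl ?lee_fin // mul1e.
(* Spacing c = 2 * n + 1 makes boxes of radius n disjoint, and N exceeds the norms of all their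
   points. *)
have bound M : (0 < M)%N -> ((M * M)%:R%:E * p <= (K * M)%:R%:E)%E.
  move=> M0; pose c := (2 * n + 1)%N; pose N := (c * M + n + 1)%N.
  pose zs : seq vertex := [seq ((c * k)%N%:Z, (c * l)%N%:Z) | k <- iota 0 M, l <- iota 0 M].
  have szs : size zs = (M * M)%N by rewrite size_allpairs size_iota.
  have zsP z : z \in zs -> exists k l, [/\ (k < M)%N, (l < M)%N & z = ((c * k)%N%:Z, (c * l)%N%:Z)].
    by case/allpairsP => -[k l] /= []; rewrite !mem_iota /= => *; exists k, l.
  have uzs : uniq zs.
    apply: allpairs_uniq; try exact: iota_uniq.
    move=> [k l] [k' l'] _ _ /= [] e1 e2; congr pair; apply/eqP.
      by rewrite -(@eqn_pmul2l c) ?e1 // /c addn1.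
    by rewrite -(@eqn_pmul2l c) ?e2 // /c addn1.
  have cnt w : (count (fun z => `[< trifurcation n z (phi w false) >]) zs <= 4 * (N + N).+1)%N.
    rewrite -size_filter; apply: (@trifurcation_count (phi w false) n).
    - exact: filter_uniq.
    - move=> z z'; rewrite !mem_filter => /andP[_ /zsP[k [l [_ _ ->]]]] /andP[_ /zsP[k' [l' [_ _ ->]]]].
      move=> ne [a b]; rewrite /box /norm /= => H; apply/negP => H'; apply: ne.
      have ek : k = k'.
        by case: (ltngtP k k') => // lt; [have := leq_mul2l c k.+1 k'|have := leq_mul2l c k'.+1 k];
          rewrite lt orbT mulnS; move: H H'; rewrite /c; lia.
      have el : l = l'.
        by case: (ltngtP l l') => // lt; [have := leq_mul2l c l.+1 l'|have := leq_mul2l c l'.+1 l];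
          rewrite lt orbT mulnS; move: H H'; rewrite /c; lia.
      by rewrite ek el.
    - move=> z; rewrite mem_filter => /andP[_ /zsP[k [l [kM lM ->]]]].
      have := leq_mul2l c k M; have := leq_mul2l c l M; rewrite (ltnW kM) (ltnW lM) !orbT.
      by rewrite /N /norm /=; lia.
    - by move=> z; rewrite mem_filter => /andP[/asboolP].
  have := sum_measure_le mu mt cnt; rewrite (eq_bigr _ (fun z _ => pz z)) sump szs => /le_trans; apply.
  rewrite lee_fin ler_nat /K /N /c; nia.
have pfin : p \is a fin_num by exact: fin_num_measure (mt _).
rewrite -(fineK pfin); congr EFin; apply/eqP; rewrite eq_le fine_ge0 ?measure_ge0 // andbT leNgt.
(* An integer M above K / p contradicts [bound]. *)
apply/negP => p0; pose x := K%:R / fine p.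
have x0 : 0 <= x by rewrite divr_ge0 // ltW.
have := archi_boundP x0; set M := Num.bound x => xM.
have M0 : (0 < M)%N by rewrite -(ltr_nat R); exact: le_lt_trans xM.
have := bound M M0; rewrite -{1}(fineK pfin) -EFinM lee_fin (natrM _ M M) (natrM _ K M).
rewrite [K%:R * _]mulrC -mulrA ler_pM2l ?ltr0n // leNgt => /negP; apply.
by rewrite -ltr_pdivrMr.
Qed.
Lemma three_infinite_null : null (fun w => three_infinite (phi w false)).
Proof.
have nT n : null (fun w => exists F, trifurcation n (0, 0) (foldr flip_face (phi w false) F)).
  apply: (null_rewired _ (trifurcation_null n)) => //.
  exact: (mpred_trifurcation n (0, 0) mbool_edge).
apply: null_sub (null_or null_Omega (null_exists nT)) => w w3.
have [Ow|] := pselect (Omega w); [right|by left].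
have [k [s [sE _]]] := spins Ow; rewrite sE in w3.
by have [n [F nF]] := three_infinite_rewire w3; exists n, F; rewrite sE.
Qed.

Lemma mpred_two l : mpred (fun w : Cfg => two_infinite (phi w l)).
Proof. by apply: mpred_two_infinite => e; exact: mbool_phi. Qed.

(** By the zero-one law it remains to exclude that two infinite contours exist almost surely. Then
    having at most one would be null; exactly two can be merged into one by flips, so exactly two is
    null as well, and three or more is null already. *)
Lemma two_infinite_null l : null (fun w => two_infinite (phi w l)).
Proof.
apply: (null_dual (fun l => mpred_two l)).
have [||//|n2] := @zero_one (fun w => two_infinite (phi w false)).
- exact: mpred_two.
- by move=> i j w; rewrite phi_shift; exact: two_infinite_shift.
have : null (fun w => two_infinite (phi w false) /\ ~ three_infinite (phi w false)).
  apply: (null_rewired _ n2) => [|w Ow [w2 w3]].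
    by apply: mpred_not; exact: (mpred_two_infinite mbool_edge).
  by have [k [s [sE _]]] := spins Ow; rewrite sE in w2 w3 *; exact: two_infinite_rewire.
move=> /(null_or three_infinite_null); apply: null_sub => w w2.
by have [|] := pselect (three_infinite (phi w false)); [left|right].
Qed.

(** * Nonexistence of infinite contours *)

Definition has_unbounded (psi : ecfg) := exists x, unbounded (adj psi) x.

Lemma mbool_adj_phi l u v : mbool (fun w : Cfg => adj (phi w l) u v).
Proof. by apply: mbool_adj => e; exact: mbool_phi. Qed.

Lemma mpred_has_unbounded l : mpred (fun w : Cfg => has_unbounded (phi w l)).
Proof. by apply: mpred_exists => x; apply: mpred_unbounded => u v; exact: mbool_adj_phi. Qed.

(** Quantifying over points avoids selecting the infinite contours, which are unique only almost
    surely. *)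
Definition positive_charge (w : cfg) := exists x y,
  [/\ unbounded (adj (phi w false)) x, unbounded (adj (phi w true)) y & contour_charge w x y].

Lemma mpred_positive_charge : mpred (fun w : Cfg => positive_charge w).
Proof.
apply: mpred_exists => x; apply: mpred_exists => y.
have mc : mbool (fun w : Cfg => contour_charge w x y).
  apply: mbool_addb; first exact: mbool_state.
  by apply: mbool_addb; apply: mbool_seg => i; exact: mbool_phi.
have := mpred_and (mpred_and (mpred_unbounded x (mbool_adj_phi false))
  (mpred_unbounded y (mbool_adj_phi true))) mc.
by apply: mpred_eq => w; split=> [[[]]|[]].
Qed.

Lemma positive_charge_translate i j w :
  positive_charge w -> positive_charge (translate (2 * i, 2 * j) w).
Proof.
move=> [x [y [ux uy c]]]; exists (x.1 + i, x.2 + j), (y.1 + i, y.2 + j).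
by rewrite !phi_shift contour_charge_translate; split=> //; exact: (@unbounded_shift (i, j)).
Qed.

Lemma has_unbounded_null l : null (fun w => has_unbounded (phi w l)).
Proof.
apply: (null_dual mpred_has_unbounded).
have [||//|n0] := @zero_one (fun w => has_unbounded (phi w false)).
- exact: mpred_has_unbounded.
- by move=> i j w [x ux]; exists (x.1 + i, x.2 + j); rewrite phi_shift; exact: (@unbounded_shift (i, j)).
have n1 := @null_dual (fun psi => ~ has_unbounded psi) (fun l => mpred_not (mpred_has_unbounded l)) n0.
exfalso; pose bad w := (~ Omega w \/ ~ has_unbounded (phi w false)) \/
  (~ has_unbounded (phi w true) \/ (two_infinite (phi w false) \/ two_infinite (phi w true))).
have nb : null bad.
  apply: null_or; first exact: (null_or null_Omega n0).
  exact: (null_or (n1 true) (null_or (two_infinite_null false) (two_infinite_null true))).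
have good w : ~ bad w -> [/\ Omega w, has_unbounded (phi w false), has_unbounded (phi w true),
    ~ two_infinite (phi w false) & ~ two_infinite (phi w true)].
  by rewrite /bad => nbw; split=> [|||H|H]; (try (apply: contrapT => H)); apply: nbw; tauto.
apply: not_null_True.
have [||nc|nc] := @zero_one positive_charge.
- exact: mpred_positive_charge.
- exact: positive_charge_translate.
  (* Null case: w and [theta w] have the same contours and opposite charges on any pair of them, so
     one of the two always has positive charge. *)
  have nt := null_theta mpred_positive_charge nc.
  apply: null_sub (null_or nb (null_or nc nt)) => w _.
  have [|/good[Ow [x ux] [y uy] _ _]] := pselect (bad w); [by left|right].
  have [c|c] := boolP (contour_charge w x y); [left|right]; exists x, y; rewrite ?phi_theta //.
  by rewrite contour_charge_theta.
(* Almost sure case: w and [theta w] both have positive charge, and by uniqueness on the same two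
   contours, where their charges are opposite. *)
have nt := null_theta (mpred_not mpred_positive_charge) nc.
apply: null_sub (null_or nb (null_or nc nt)) => w _.
have [|/good[Ow _ _ t0 t1]] := pselect (bad w); [by left|right].
have [[x [y [ux uy c]]]|] := pselect (positive_charge w); [right|by left].
move=> [x' [y' []]]; rewrite !phi_theta contour_charge_theta => ux' uy' /negP; apply.
rewrite -(contour_charge_const Ow (x := x) (y := y)) //; apply: contrapT => nconn.
  by apply: t0; exists x, x'.
by apply: t1; exists y, y'.
Qed.

(** Here p locates the elements of A in the grid and [r n] lists all elements located in the ball of
    radius n, so an infinite A leaves every ball. *)
Lemma infinite_unbounded (T : choiceType) (e : rel vertex) (A : set T) (p : T -> vertex)
    (r : nat -> seq T) v : (forall t n, (norm (p t) <= n)%N -> t \in r n) ->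
  (forall t, A t -> conn e v (p t)) -> ~ finite_set A -> unbounded e v.
Proof.
move=> rP Ac nA m; apply: contrapT => nm; apply: nA.
apply: (@sub_finite_set _ _ [set` r m]); last exact: finite_seq.
move=> t /Ac vt; apply: rP; rewrite leqNgt; apply/negP => mt.
by apply: nm; exists (p t) => //; exact: ltnW.
Qed.

Lemma latpt_inj l : injective (latpt l).
Proof. by case: l => -[a b] [c d] /= [] e1 e2; congr pair; lia. Qed.

Lemma infinite_contour_unbounded w l : has_infinite_contour w l -> has_unbounded (phi w l).
Proof.
move=> [e [pe infe]]; exists e.1.
apply: (@infinite_unbounded _ _ (contour w l e) fst
  (fun n => [seq (x, h) | x <- ball_seq n, h <- [:: true; false]])) infe => [[x h] n|f].
  rewrite [norm _]/(norm x) => xn.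
  by apply/allpairsP; exists (x, h); rewrite mem_ball_seq; case: h.
have present_adj g : present w l g -> conn (adj (phi w l)) g.1 (tip g) /\ conn (adj (phi w l)) (tip g) g.1.
  move=> pg; have {pg} : phi w l g by apply/asboolP.
  by move=> /adj_edge a; split; apply: conn1 => //; rewrite adj_sym.
elim=> {f} [f g [pf [pg fg]]|f|f g h _ IH _ IH'].
- have [f1 f2] := present_adj f pf; have [g1 g2] := present_adj g pg.
  case: fg => [/latpt_inj ->|[/latpt_inj H|[/latpt_inj H|/latpt_inj H]]].
  + exact: conn0.
  + by rewrite [f.1]H.
  + by rewrite -[g.1]H.
  + by apply: (conn_trans f1); rewrite [X in conn _ X _]H.
- exact: conn0.
- exact: conn_trans IH IH'.
Qed.

Lemma infinite_contour_null l : null (fun w => has_infinite_contour w l).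
Proof. apply: null_sub (has_unbounded_null l) => w; exact: infinite_contour_unbounded. Qed.

(** * Nonexistence of infinite clusters *)

Lemma infinite_cluster_color w : has_infinite_cluster w -> exists b, infinite_color b w.
Proof.
move=> [v infv]; exists (w v), v => //.
apply: (@infinite_unbounded _ _ (Defs.cluster w v) id ball_seq) infv => [x n|x].
  by rewrite mem_ball_seq.
elim=> {x} [x y [xy wxy]|x|x y z _ IH _ IH'].
- by apply: conn1; apply/andP; split; apply/eqP.
- exact: conn0.
- exact: conn_trans IH IH'.
Qed.

Lemma mpred_infinite_color b : mpred (fun w : Cfg => infinite_color b w).
Proof.
apply: mpred_exists2 => v; first exact: (mbool_eq (mbool_state v) (mbool_cst b)).
apply: mpred_unbounded => x y; apply: mbool_and; first exact: mbool_cst.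
have := mbool_eq (mbool_state x) (mbool_state y).
by apply: mpred_eq => w; split=> /eqP.
Qed.

Lemma infinite_color_translate i j b w :
  infinite_color b w -> infinite_color b (translate (2 * i, 2 * j) w).
Proof.
pose f (u : vertex) : vertex := (u.1 + 2 * i, u.2 + 2 * j).
pose g (u : vertex) : vertex := (u.1 - 2 * i, u.2 - 2 * j).
have fK : cancel f g by move=> [a c]; rewrite /f /g /= !addrK.
have gK : cancel g f by move=> [a c]; rewrite /f /g /= !subrK.
have tf u : translate (2 * i, 2 * j) w (f u) = w u.
  by rewrite /translate -[in RHS](fK u).
move=> [v wv uv]; exists (f v); first by rewrite tf.
apply: (unbounded_iso _ fK gK (c := norm (2 * i, 2 * j))) uv => [x y|x].
  by rewrite /same_state !tf /f /=; congr (_ && _); congr (_ + _ == _); congr `|_|; lia.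
exact: (@norm_shift (2 * i, 2 * j)).
Qed.

Lemma infinite_color_theta b w : infinite_color (~~ b) w -> infinite_color b (theta w).
Proof.
move=> [v wv uv]; exists v; first by rewrite /theta wv negbK.
suff <- : same_state w = same_state (theta w) by [].
apply/funext => x; apply/funext => y; rewrite /same_state /theta; congr andb.
by case: (w x); case: (w y).
Qed.

(** The zero-one law is applied to infinite clusters of state 1. If they are null, [theta] disposes
    of state 0; if they are almost sure, [theta] yields both states at once, which is impossible
    when all contours are finite. *)
Lemma infinite_cluster_null : null has_infinite_cluster.
Proof.
have [||nt|nt] := @zero_one (infinite_color true).
- exact: mpred_infinite_color.
- by move=> i j w; exact: infinite_color_translate.
  apply: null_sub (null_or nt (null_theta (mpred_infinite_color true) nt)) => w.
  by move=> /infinite_cluster_color[[|] cw]; [left|right; exact: infinite_color_theta].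
exfalso; apply: not_null_True.
have nt' := null_theta (mpred_not (mpred_infinite_color true)) nt.
have nu := null_or (has_unbounded_null false) (has_unbounded_null true).
apply: null_sub (null_or (null_or null_Omega nu) (null_or nt nt')) => w _.
apply: contrapT => H; have Ow : Omega w by apply: contrapT; tauto.
have bd l x : ~ unbounded (adj (phi w l)) x.
  move=> ux; apply: H; left; right; have : has_unbounded (phi w l) by exists x.
  by case: l {ux}; [right|left].
have ct : infinite_color true w by apply: contrapT; tauto.
have ct' : infinite_color true (theta w) by apply: contrapT; tauto.
apply: (infinite_color_contour Ow bd ct).
have := @infinite_color_theta false (theta w) ct'.
by rewrite (_ : theta (theta w) = w) //; apply/funext => v; rewrite /theta negbK.
Qed.
End Assembly.

Theorem theorem1p2 (R : realType) (mu : probability Cfg R) :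
  (* mu is a probability measure on Omega *)
  mu Omega = 1%E ->
  (* (A1) invariance under the translations of the group generated by
     (1,1) and (1,-1) *)
  (forall (i j : int) (A : set Cfg), measurable A ->
     mu (translate (i + j, i - j) @^-1` A) = mu A) ->
  (* (A2) every 2Z x 2Z-translation-invariant event has probability 0 or 1 *)
  (forall A : set Cfg, measurable A ->
     (forall i j : int, translate (2 * i, 2 * j) @^-1` A = A) ->
     mu A = 0%E \/ mu A = 1%E) ->
  (* (A3) invariance under theta *)
  (forall A : set Cfg, measurable A -> mu (theta @^-1` A) = mu A) ->
  (* (A4) finite energy of nu1 = law of phi1 *)
  (forall (S : int * int) (E : set ECfg), measurable E ->
     (0 < pushforward mu phi1 E)%E ->
     (0 < pushforward mu phi1 (flip_face S @` E))%E) ->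
  (* (1) a.s. no infinite primal and no infinite dual contours *)
  {ae mu, forall w : Cfg,
     ~ has_infinite_contour w false /\ ~ has_infinite_contour w true} /\
  (* (2) a.s. no infinite clusters *)
  {ae mu, forall w : Cfg, ~ has_infinite_cluster w}.
Proof.
move=> muO A1 A2 A3 A4; have nc := infinite_contour_null muO A1 A2 A3 A4; split.
  apply: null_sub (null_or (nc false) (nc true)) => w H; apply: contrapT => H'.
  by apply: H; split=> h; apply: H'; [left|right].
by apply: null_sub (infinite_cluster_null muO A1 A2 A3 A4) => w /contrapT.
Qed.
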